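(* Let $G$ be a (simply connected) semisimple algebraic group over $\mathbb{C}$ with maximal torus $T$, opposite maximal unipotent subgroups $U$ and $U^-$, and $B^-=U^-T$. For $i\in I$ let $f_i:U^-\to\mathbb{C}$ be the matrix coefficient $f_i(g)=\langle g\cdot u_{\Lambda_i},v^*_{\Lambda_i}\rangle$. Then the rational morphism $$F:U^-\to B^-,\qquad F(u):=u\cdot\prod_{i\in I}\alpha_i^\vee\big(f_i(u)^{-1}\big)$$ is a $U$-morphism, i.e. $F(\alpha_{U^-}(x,u))=\alpha_{B^-}(x,F(u))$ for $x\in U$, $u\in U^-$, as rational morphisms.
   Context: Let $\mathfrak{g}=\mathrm{Lie}(G)$ with Chevalley generators $e_i,f_i$ ($i\in I$), simple roots $\alpha_i$, simple coroots $\alpha_i^\vee:\mathbb{C}^\times\to T$, and fundamental weights $\Lambda_i\in X^*(T)$, so $\Lambda_i(\alpha_j^\vee(c))=c^{\delta_{ij}}$. $U$ (resp. $U^-$) is the maximal unipotent subgroup generated by the positive (resp. negative) root subgroups. The multiplication map $U^-\times T\times U\hookrightarrow G$ is an open embedding. For $g=g^-g^0g^+$ in its image put $\pi^{--}(g)=g^-$ and $\pi^-(g)=g^-g^0$ (rational morphisms). The rational $U$-actions are $\alpha_{U^-}(x,u)=\pi^{--}(xu)$ on $U^-$ and $\alpha_{B^-}(x,b)=\pi^-(xb)$ on $B^-$. $L(\Lambda_i)$ is the irreducible highest weight $\mathfrak{g}$-module with highest weight $\Lambda_i$. Let $\omega$ be the Chevalley involution ($\omega(e_i)=-f_i$, $\omega(f_i)=-e_i$,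 $\omega(h)=-h$ for $h$ in the Cartan subalgebra). $L^*(\Lambda_i)$ is the same vector space with $\mathfrak{g}$-action twisted by $\omega$; a vector $v\in L(\Lambda_i)$ regarded in $L^*(\Lambda_i)$ is written $v^*$. $\langle\ ,\ \rangle$ is the unique $\mathfrak{g}$-invariant bilinear form on $L(\Lambda_i)\times L^*(\Lambda_i)$ with $\langle u_{\Lambda_i},u^*_{\Lambda_i}\rangle=1$, where $u_{\Lambda_i}$ is a fixed highest weight vector; $v_{\Lambda_i}$ is a lowest weight vector normalized by $\langle v_{\Lambda_i},v^*_{\Lambda_i}\rangle=1$. *)

(* Defs.v *)
From HB Require Import structures.
From mathcomp Require Import all_boot all_order all_algebra.
From mathcomp Require Import boolp classical_sets reals.
From mathcomp Require Import complex.

Set Implicit Arguments.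
Unset Strict Implicit.
Unset Printing Implicit Defensive.

Import GRing.Theory Num.Theory.
Local Open Scope classical_set_scope.
Local Open Scope ring_scope.

(* Varieties are subsets of finite-dimensional K-vector spaces, with the
   topology and the regular functions induced by the ambient space. *)
Section Varieties.
Context {K : fieldType}.

Inductive polyfun (V : lmodType K) : (V -> K) -> Prop :=
| polyfun_const (c : K) : polyfun (fun=> c)
| polyfun_linear (l : {scalar V}) : polyfun l
| polyfun_add (P Q : V -> K) :
    polyfun P -> polyfun Q -> polyfun (fun x => P x + Q x)
| polyfun_mul (P Q : V -> K) :
    polyfun P -> polyfun Q -> polyfun (fun x => P x * Q x).

Definition zclosed (V : lmodType K) (Z : set V) : Prop :=
  exists2 S : set (V -> K), S `<=` @polyfun V &
    Z = [set x | forall P, S P -> P x = 0].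

Definition zopen_in (V : lmodType K) (X O : set V) : Prop :=
  exists2 Z : set V, zclosed Z & O = X `\` Z.

Definition zdense_in (V : lmodType K) (X O : set V) : Prop :=
  forall Z : set V, zclosed Z -> O `<=` Z -> X `<=` Z.

Definition zconnected (V : lmodType K) (X : set V) : Prop :=
  X !=set0 /\
  forall Z1 Z2 : set V, zclosed Z1 -> zclosed Z2 ->
    X `<=` Z1 `|` Z2 -> X `&` Z1 `&` Z2 = set0 -> X `<=` Z1 \/ X `<=` Z2.

Definition regular_on (V : lmodType K) (X : set V) (f : V -> K) : Prop :=
  forall p, X p -> exists P Q : V -> K,
    [/\ polyfun P, polyfun Q, Q p != 0 &
        forall x, X x -> Q x != 0 -> f x = P x / Q x].

Definition is_morphism (V W : lmodType K) (X : set V) (Y : set W)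
    (phi : V -> W) : Prop :=
  (forall x, X x -> Y (phi x)) /\
  (forall l : {scalar W}, regular_on X (fun x => l (phi x))).

Definition is_isomorphism (V W : lmodType K) (X : set V) (Y : set W)
    (phi : V -> W) : Prop :=
  is_morphism X Y phi /\
  exists psi : W -> V,
    [/\ is_morphism Y X psi, forall x, X x -> psi (phi x) = x &
        forall y, Y y -> phi (psi y) = y].

Definition open_embedding (V W : lmodType K) (X : set V) (Y : set W)
    (phi : V -> W) : Prop :=
  zopen_in Y (phi @` X) /\ is_isomorphism X (phi @` X) phi.

(* A partially defined map from V to W is given by its graph R : V -> W -> Prop.
   Two such partial maps define the same rational morphism X --> Y when, on some
   dense open subset O of X, both are defined and equal to one morphism O -> Y. *)
Definition rat_eq (V W : lmodType K) (X : set V) (Y : set W)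
    (R S : V -> W -> Prop) : Prop :=
  exists (O : set V) (phi : V -> W),
    [/\ zopen_in X O, zdense_in X O, is_morphism O Y phi,
        forall x, O x -> forall y, R x y <-> y = phi x &
        forall x, O x -> forall y, S x y <-> y = phi x].

Definition is_rational (V W : lmodType K) (X : set V) (Y : set W)
    (R : V -> W -> Prop) : Prop := rat_eq X Y R R.

(* f (a (h, x)) = b (h, f x) as rational morphisms H x X --> Y. *)
Definition rational_equivariant (E V W : lmodType K)
    (H : set E) (X : set V) (Y : set W)
    (a : E * V -> V -> Prop) (b : E * W -> W -> Prop) (f : V -> W -> Prop) :
    Prop :=
  rat_eq (H `*` X) Y
    (fun p y => exists2 x', a p x' & f x' y)
    (fun p y => exists2 y', f p.2 y' & b (p.1, y') y).

(* d is the derivative at p of the polynomial function P in the direction X. *)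
Definition poly_deriv (V : lmodType K) (P : V -> K) (p X : V) (d : K) : Prop :=
  exists2 q : {poly K}, forall t : K, P (p + t *: X) = q.[t] & q`_1 = d.

Definition tangent_space (V : lmodType K) (A : set V) (p : V) : set V :=
  [set X | forall P : V -> K, polyfun P -> (forall a, A a -> P a = 0) ->
     poly_deriv P p X 0].

(* Quotient rule on local expressions l \o phi = P / Q; for A regular near p
   and X tangent to A at p there is exactly one such Y. *)
Definition is_differential (V W : lmodType K) (A : set V) (phi : V -> W)
    (p X : V) (Y : W) : Prop :=
  forall l : {scalar W}, exists (P Q : V -> K) (dP dQ : K),
    [/\ polyfun P /\ polyfun Q, Q p != 0,
        forall a, A a -> Q a != 0 -> l (phi a) = P a / Q a,
        poly_deriv P p X dP /\ poly_deriv Q p X dQ &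
        l Y = (dP * Q p - P p * dQ) / Q p ^+ 2].

Definition differential (V W : lmodType K) (A : set V) (phi : V -> W)
    (p X : V) : W := xget 0 [set Y | is_differential A phi p X Y].

End Varieties.

Section AlgebraicGroups.
Context {K : fieldType} {n : nat}.
Local Notation M := 'M[K]_n.

Definition GL : set M := [set A | A \in unitmx].

Definition is_subgroup (H : set M) : Prop :=
  [/\ H `<=` GL, H 1%:M,
      forall A B, H A -> H B -> H (A *m B) & forall A, H A -> H (invmx A)].

Definition generated (S : set M) : set M :=
  [set A | forall H, is_subgroup H -> S `<=` H -> H A].

Definition algebraic_group (H : set M) : Prop :=
  is_subgroup H /\ exists2 Z, zclosed Z & H = Z `&` GL.

Definition set_mul (A B : set M) : set M :=
  [set g | exists a b, [/\ A a, B b & g = a *m b]].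

Definition derived_group (H : set M) : set M :=
  generated [set g | exists a b, [/\ H a, H b &
                       g = invmx a *m invmx b *m a *m b]].

Definition solvable_group (H : set M) : Prop :=
  exists k : nat, iter k derived_group H `<=` [set 1%:M].

Definition normal_in (G H : set M) : Prop :=
  H `<=` G /\ forall g h, G g -> H h -> H (g *m h *m invmx g).

Definition semisimple (G : set M) : Prop :=
  [/\ algebraic_group G, zconnected G &
      forall H, algebraic_group H -> zconnected H -> solvable_group H ->
        normal_in G H -> H `<=` [set 1%:M]].

(* The multiplicative group, inside the affine line K^o. *)
Definition Gm : set K^o := [set c | c != 0].

Definition Gm_pow (r : nat) : set 'rV[K]_r :=
  [set v | forall j, v ord0 j != 0].

Definition is_torus (T : set M) : Prop :=
  algebraic_group T /\
  exists (r : nat) (phi : 'rV[K]_r -> M),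
    is_isomorphism (@Gm_pow r) T phi /\
    forall v w, Gm_pow v -> Gm_pow w ->
      phi (\row_j (v ord0 j * w ord0 j)) = phi v *m phi w.

Definition maximal_torus (G T : set M) : Prop :=
  [/\ is_torus T, T `<=` G &
      forall T', is_torus T' -> T' `<=` G -> T `<=` T' -> T' = T].

(* X^*(T); only the values on T matter. *)
Definition is_character (T : set M) (chi : M -> K^o) : Prop :=
  is_morphism T Gm chi /\
  forall s t, T s -> T t -> chi (s *m t) = chi s * chi t.

(* X_*(T); only the values on nonzero scalars matter. *)
Definition is_cocharacter (T : set M) (lam : K^o -> M) : Prop :=
  is_morphism Gm T lam /\
  forall a b, Gm a -> Gm b -> lam (a * b) = lam a *m lam b.

Definition Lie (G : set M) : set M := tangent_space G 1%:M.

Definition bracket (X Y : M) : M := X *m Y - Y *m X.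

Definition root_space (G T : set M) (beta : M -> K^o) : set M :=
  [set X | Lie G X /\
     forall t, T t -> t *m X *m invmx t = (beta t : K) *: X].

Definition is_root (G T : set M) (beta : M -> K^o) : Prop :=
  [/\ is_character T beta, exists2 t, T t & beta t != 1 &
      exists2 X, root_space G T beta X & X != 0].

(* x is an isomorphism of the additive group onto the root subgroup U_beta. *)
Definition root_hom (G T : set M) (beta : M -> K^o) (x : K^o -> M) : Prop :=
  [/\ forall c, G (x c),
      is_isomorphism setT (range x) x,
      forall a b, x (a + b) = x a *m x b &
      forall t c, T t -> t *m x c *m invmx t = x (beta t * c)].

Definition root_subgroup (G T : set M) (beta : M -> K^o) : set M :=
  [set g | exists x c, root_hom G T beta x /\ g = x c].

Definition inv_char (chi : M -> K^o) : M -> K^o := fun t => (chi t)^-1.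

Section Based.
Context {I : finType}.

Definition positive_root (G T : set M) (alpha : I -> M -> K^o)
    (beta : M -> K^o) : Prop :=
  is_root G T beta /\
  exists m : I -> nat, forall t, T t -> beta t = \prod_i alpha i t ^+ m i.

Definition negative_root (G T : set M) (alpha : I -> M -> K^o)
    (beta : M -> K^o) : Prop :=
  is_root G T beta /\
  exists m : I -> nat, forall t, T t -> beta t = \prod_i alpha i t ^- m i.

(* The alpha i form a base of the root system of (G, T); characters are written
   multiplicatively. *)
Definition simple_roots (G T : set M) (alpha : I -> M -> K^o) : Prop :=
  [/\ forall i, is_root G T (alpha i),
      forall m : I -> int, (forall t, T t -> \prod_i alpha i t ^ m i = 1) ->
        forall i, m i = 0 &
      forall beta, is_root G T beta ->
        positive_root G T alpha beta \/ negative_root G T alpha beta].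

Definition Uplus (G T : set M) (alpha : I -> M -> K^o) : set M :=
  generated [set g | exists2 beta, positive_root G T alpha beta &
                       root_subgroup G T beta g].

Definition Uminus (G T : set M) (alpha : I -> M -> K^o) : set M :=
  generated [set g | exists2 beta, negative_root G T alpha beta &
                       root_subgroup G T beta g].

(* e i and f i are simple root vectors, and [e i, f i] is the simple coroot: it
   is the differential at 1 of the cocharacter alphav i, and
   <alpha i, alphav i> = 2. *)
Definition chevalley_generators (G T : set M) (alpha : I -> M -> K^o)
    (alphav : I -> K^o -> M) (e f : I -> M) : Prop :=
  forall i,
    [/\ root_space G T (alpha i) (e i),
        root_space G T (inv_char (alpha i)) (f i),
        is_cocharacter T (alphav i),
        bracket (e i) (f i) = differential Gm (alphav i) 1 1 &
        forall c, Gm c -> alpha i (alphav i c) = c ^+ 2].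

(* X_*(T) is the coroot lattice. *)
Definition simply_connected (T : set M) (alphav : I -> K^o -> M) : Prop :=
  forall lam, is_cocharacter T lam ->
    exists m : I -> int, forall c, Gm c -> lam c = \prod_i alphav i (c ^ m i).

Definition fundamental_weights (T : set M) (alphav : I -> K^o -> M)
    (Lam : I -> M -> K^o) : Prop :=
  forall i, is_character T (Lam i) /\
    forall j c, Gm c -> Lam i (alphav j c) = c ^+ (i == j).

Definition chevalley_involution (G T : set M) (e f : I -> M) (omega : M -> M) :
    Prop :=
  [/\ forall X, Lie G X -> Lie G (omega X) /\ omega (omega X) = X,
      forall (a : K) X Y, Lie G X -> Lie G Y ->
        omega (a *: X + Y) = a *: omega X + omega Y,
      forall X Y, Lie G X -> Lie G Y ->
        omega (bracket X Y) = bracket (omega X) (omega Y),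
      forall i, omega (e i) = - f i /\ omega (f i) = - e i &
      forall H, Lie T H -> omega H = - H].

Section Modules.
Context {V : vectType K}.

Definition rational_rep (G : set M) (rho : M -> 'End(V)) : Prop :=
  [/\ is_morphism G setT rho, rho 1%:M = \1%VF &
      forall g h, G g -> G h -> rho (g *m h) = (rho g \o rho h)%VF].

(* The action of Lie G underlying a rational representation of G. *)
Definition drho (G : set M) (rho : M -> 'End(V)) (X : M) : 'End(V) :=
  differential G rho 1%:M X.

Definition irreducible_module (g : set M) (act : M -> 'End(V)) : Prop :=
  (exists v : V, v != 0) /\
  forall W : {vspace V},
    (forall X w, g X -> w \in W -> act X w \in W) -> W = 0%VS \/ W = fullv.

Definition weight_vector (T : set M) (rho : M -> 'End(V)) (lam : M -> K^o)
    (v : V) : Prop :=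
  v != 0 /\ forall t, T t -> rho t v = (lam t : K) *: v.

Definition highest_weight_vector (G T : set M) (alpha : I -> M -> K^o)
    (rho : M -> 'End(V)) (lam : M -> K^o) (v : V) : Prop :=
  weight_vector T rho lam v /\
  forall beta X, positive_root G T alpha beta -> root_space G T beta X ->
    drho G rho X v = 0.

Definition lowest_weight_vector (G T : set M) (alpha : I -> M -> K^o)
    (rho : M -> 'End(V)) (v : V) : Prop :=
  (exists2 mu, is_character T mu & weight_vector T rho mu v) /\
  forall beta X, negative_root G T alpha beta -> root_space G T beta X ->
    drho G rho X v = 0.

(* The irreducible highest weight module L(lam), with its integrated G-action
   rho and highest weight vector u. *)
Definition irreducible_highest_weight (G T : set M) (alpha : I -> M -> K^o)
    (lam : M -> K^o) (rho : M -> 'End(V)) (u : V) : Prop :=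
  [/\ rational_rep G rho, irreducible_module (Lie G) (drho G rho) &
      highest_weight_vector G T alpha rho lam u].

(* L^*(lam) is V with the action twisted by omega, so the pairing <v, w^*> is a
   form B v w on V x V. *)
Definition twisted_action (omega : M -> M) (act : M -> 'End(V)) : M -> 'End(V) :=
  fun X => act (omega X).

Definition invariant_form (g : set M) (act act' : M -> 'End(V))
    (B : V -> V -> K) : Prop :=
  [/\ forall w, scalar (B^~ w), forall v, scalar (B v) &
      forall X v w, g X -> B (act X v) w + B v (act' X w) = 0].

End Modules.

(* Graph of pi^{--}, resp. of pi^-. *)
Definition pi_mm (Um T U : set M) (g gm : M) : Prop :=
  exists g0 gp, [/\ Um gm, T g0, U gp & g = gm *m g0 *m gp].

Definition pi_m (Um T U : set M) (g b : M) : Prop :=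
  exists gm g0 gp,
    [/\ Um gm, T g0, U gp, g = gm *m g0 *m gp & b = gm *m g0].

Definition act_Um (Um T U : set M) (p : M * M) (y : M) : Prop :=
  [/\ U p.1, Um p.2 & pi_mm Um T U (p.1 *m p.2) y].

Definition act_Bm (Um T U : set M) (p : M * M) (y : M) : Prop :=
  [/\ U p.1, set_mul Um T p.2 & pi_m Um T U (p.1 *m p.2) y].

(* Graph of u |-> u * \prod_i alphav i (coef i u)^-1, where every coef i u must
   be invertible. *)
Definition F_map (Um : set M) (alphav : I -> K^o -> M) (coef : I -> M -> K)
    (u b : M) : Prop :=
  [/\ Um u, forall i, coef i u != 0 &
      b = u *m \prod_i alphav i (coef i u)^-1].

End Based.
End AlgebraicGroups.

(* Main.v *)
(* The coefficient f_i is invariant under left translation by U, because the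
   Chevalley involution sends positive root vectors to negative ones and v_i is a
   lowest weight vector, and f_i (g^- g^0 g^+) = Lam_i (g^0) f_i (g^-).  Hence, if
   x u = g^- g^0 g^+, then Lam_i (g^0) = f_i (u) / f_i (g^-); as G is simply
   connected, g^0 is the product of the alphav_i (Lam_i (g^0)), and the two sides
   of the equivariance both equal g^- g^0 times the product of the
   alphav_i (f_i (u)^-1).
   Infinitesimal invariance integrates along one-parameter subgroups, since a
   regular function on the line or on Gm with zero derivative is constant.
   Density is checked along lines: any two points of U, or of U^-, lie on the
   image of one morphism from the affine line. *)
Require Import Defs.
From HB Require Import structures.
From mathcomp Require Import all_boot all_order all_algebra.
From mathcomp Require Import boolp classical_sets reals.
From mathcomp Require Import complex.
From mathcomp Require Import ring.

Set Implicit Arguments.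
Unset Strict Implicit.
Unset Printing Implicit Defensive.

Import GRing.Theory Num.Theory.
Local Open Scope classical_set_scope.
Local Open Scope ring_scope.

(** * Derivatives of regular functions *)

Section Derivatives.
Context {K : numFieldType}.
Implicit Types (U V W : lmodType K).

(** [F] can be rational only if no f_i vanishes identically on U^-, and this uses the irreducibility
    of L(Lam_i): a coefficient vanishing on U^- vanishes on the open cell, so the functional <.,
    v_i^*> kills the span of the cell's orbit of u_i. That span is stable under Lie G, hence
    everything, against <v_i, v_i^*> = 1. In the equivariance, the torus factor of [F] stands to the
    right of u, so the U-factor of x u has to be moved across it. T normalises U, and factorizations
    in the open cell are unique, which identifies the result. Differentials are relations, defined
    through a choice of local quotients P / Q and determined only along tangent vectors. Arguments
    by differentiation therefore compute one derivative in two ways and conclude by uniqueness.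
    Characteristic zero makes the field infinite, so that polynomials are determined by their
    values, and makes a regular function on the line with zero derivative constant. *)

Lemma poly_nonroot (p : {poly K}) : p != 0 -> exists c, p.[c] != 0.
Proof.
move=> p0; apply: contrapT => H.
have := @max_poly_roots K p [seq i%:R | i <- iota 0 (size p)] p0.
rewrite size_map size_iota ltnn => E; suff: false by [].
apply: E.
  by apply/allP => x _; apply/negPn/negP => Hx; apply: H; exists x.
by rewrite map_inj_uniq ?iota_uniq // => i j /eqP; rewrite eqr_nat => /eqP.
Qed.

Lemma poly_ext (p q : {poly K}) : (forall c, p.[c] = q.[c]) -> p = q.
Proof.
move=> H; apply/eqP; rewrite -subr_eq0; apply/negPn/negP => /poly_nonroot[c].
by rewrite hornerD hornerN H subrr eqxx.
Qed.

Lemma poly_derivU V (P : V -> K) p X d1 d2 :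
  poly_deriv P p X d1 -> poly_deriv P p X d2 -> d1 = d2.
Proof.
move=> [q1 H1 <-] [q2 H2 <-]; congr (_`_ _); congr polyseq.
by apply: poly_ext => c; rewrite -H1 H2.
Qed.

Lemma poly_deriv_val V (P : V -> K) (q : {poly K}) p X :
  (forall t : K, P (p + t *: X) = q.[t]) -> P p = q`_0.
Proof. by move=> H; rewrite -horner_coef0 -H scale0r addr0. Qed.

Lemma poly_deriv_const V (c : K) p X : poly_deriv (fun _ : V => c) p X 0.
Proof. by exists c%:P => [t|]; rewrite ?hornerC ?coefC. Qed.

Lemma poly_deriv_linear V (l : {scalar V}) p X : poly_deriv l p X (l X).
Proof.
exists ((l p)%:P + (l X)%:P * 'X) => [t|].
  by rewrite linearD linearZ /= hornerD hornerC hornerM hornerC hornerX mulrC.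
by rewrite coefD coefC coefMX coefC /= add0r.
Qed.

Lemma poly_derivD V (P Q : V -> K) p X a b :
  poly_deriv P p X a -> poly_deriv Q p X b ->
  poly_deriv (fun x => P x + Q x) p X (a + b).
Proof.
move=> [q1 H1 <-] [q2 H2 <-]; exists (q1 + q2) => [t|]; last by rewrite coefD.
by rewrite H1 H2 hornerD.
Qed.

Lemma poly_derivM V (P Q : V -> K) p X a b :
  poly_deriv P p X a -> poly_deriv Q p X b ->
  poly_deriv (fun x => P x * Q x) p X (a * Q p + P p * b).
Proof.
move=> [q1 H1 <-] [q2 H2 <-]; exists (q1 * q2) => [t|].
  by rewrite H1 H2 hornerM.
rewrite (poly_deriv_val H1) (poly_deriv_val H2) coefM !big_ord_recl big_ord0 /=.
by rewrite addr0 addrC.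
Qed.

Lemma poly_deriv_ex V (P : V -> K) p X :
  polyfun P -> exists d, poly_deriv P p X d.
Proof.
elim=> [c|l|{}P Q _ [a Ha] _ [b Hb]|{}P Q _ [a Ha] _ [b Hb]].
- by exists 0; apply: poly_deriv_const.
- by exists (l X); apply: poly_deriv_linear.
- by exists (a + b); apply: poly_derivD.
- by exists (a * Q p + P p * b); apply: poly_derivM.
Qed.

Lemma poly_deriv0 V (P : V -> K) p : polyfun P -> poly_deriv P p 0 0.
Proof.
by move=> _; exists (P p)%:P => [t|]; rewrite ?hornerC ?coefC ?scaler0 ?addr0.
Qed.

(** The clause of [is_differential] for a single scalar function. It is a relation because the local
    expression [P / Q] is a choice; [deriv_at_uniq] removes the choice at points of [A] when [X] is
    tangent. *)
Definition deriv_at V (A : set V) (p X : V) (f : V -> K) (d : K) : Prop :=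
  exists (P Q : V -> K) (dP dQ : K),
    [/\ polyfun P /\ polyfun Q, Q p != 0,
        forall a, A a -> Q a != 0 -> f a = P a / Q a,
        poly_deriv P p X dP /\ poly_deriv Q p X dQ &
        d = (dP * Q p - P p * dQ) / Q p ^+ 2].

Lemma deriv_at_polyfun V (A : set V) p X P d :
  polyfun P -> poly_deriv P p X d -> deriv_at A p X P d.
Proof.
move=> hP hd; exists P, (fun=> 1), d, 0; split=> //.
- by split=> //; apply: polyfun_const.
- exact: oner_neq0.
- by move=> a _ _; rewrite divr1.
- by split=> //; apply: poly_deriv_const.
- by rewrite mulr1 mulr0 subr0 expr1n divr1.
Qed.

Lemma deriv_at_cst V (A : set V) p X c : deriv_at A p X (fun=> c) 0.
Proof. by apply: deriv_at_polyfun; [apply: polyfun_const|apply: poly_deriv_const]. Qed.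

Lemma deriv_at_linear V (A : set V) p X (l : {scalar V}) : deriv_at A p X l (l X).
Proof. by apply: deriv_at_polyfun; [apply: polyfun_linear|apply: poly_deriv_linear]. Qed.

Lemma deriv_at_ext V (A B : set V) p X f g d :
  A `<=` B -> (forall a, A a -> f a = g a) -> deriv_at B p X f d ->
  deriv_at A p X g d.
Proof.
move=> AB fg [P [Q [dP [dQ [h1 h2 h3 h4 h5]]]]].
by exists P, Q, dP, dQ; split=> // a Aa Qa; rewrite -fg // h3 //; apply: AB.
Qed.

Lemma deriv_atD V (A : set V) p X f g a b :
  deriv_at A p X f a -> deriv_at A p X g b ->
  deriv_at A p X (fun x => f x + g x) (a + b).
Proof.
move=> [P [Q [dP [dQ [[hP hQ] Q0 hf [dP' dQ'] ->]]]]].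
move=> [R [S [dR [dS [[hR hS] S0 hg [dR' dS'] ->]]]]].
exists (fun x => P x * S x + R x * Q x), (fun x => Q x * S x).
eexists; eexists; split; last first.
- shelve.
- split; last by apply: poly_derivM; eassumption.
  by apply: poly_derivD; apply: poly_derivM; eassumption.
- move=> x Ax; rewrite mulf_eq0 negb_or => /andP[Qx Sx].
  by rewrite hf // hg //; field; rewrite Qx Sx.
- by rewrite mulf_neq0.
- by split; [apply: polyfun_add|]; apply: polyfun_mul.
Unshelve.
by field; rewrite Q0 S0.
Qed.

Lemma deriv_atM V (A : set V) p X f g a b : A p ->
  deriv_at A p X f a -> deriv_at A p X g b ->
  deriv_at A p X (fun x => f x * g x) (a * g p + f p * b).
Proof.
move=> Ap [P [Q [dP [dQ [[hP hQ] Q0 hf [dP' dQ'] ->]]]]].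
move=> [R [S [dR [dS [[hR hS] S0 hg [dR' dS'] ->]]]]].
exists (fun x => P x * R x), (fun x => Q x * S x).
eexists; eexists; split; last first.
- shelve.
- by split; apply: poly_derivM; eassumption.
- move=> x Ax; rewrite mulf_eq0 negb_or => /andP[Qx Sx].
  by rewrite hf // hg //; field; rewrite Qx Sx.
- by rewrite mulf_neq0.
- by split; apply: polyfun_mul.
Unshelve.
by rewrite hf // hg //; field; rewrite Q0 S0.
Qed.

Lemma deriv_at_div V (A : set V) p X f g h a b : A p -> g p != 0 ->
  (forall x, A x -> g x != 0 -> h x = f x / g x) ->
  deriv_at A p X f a -> deriv_at A p X g b ->
  deriv_at A p X h ((a * g p - f p * b) / g p ^+ 2).
Proof.
move=> Ap g0 hh [P [Q [dP [dQ [[hP hQ] Q0 hf [dP' dQ'] ->]]]]].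
move=> [R [S [dR [dS [[hR hS] S0 hg [dR' dS'] ->]]]]].
have R0 : R p != 0 by apply: contra_neq g0 => R0; rewrite hg // R0 mul0r.
exists (fun x => P x * S x * S x), (fun x => Q x * R x * S x).
eexists; eexists; split; last first.
- shelve.
- by split; do 2 (apply: poly_derivM; last eassumption); eassumption.
- move=> x Ax; rewrite !mulf_eq0 !negb_or -andbA => /and3P[Qx Rx Sx].
  rewrite hh // hg // ?hf //; last by rewrite mulf_neq0 ?invr_eq0.
  by field; rewrite Qx Rx Sx.
- by rewrite !mulf_neq0.
- by split; do 2 (apply: polyfun_mul => //).
Unshelve.
by rewrite hf // hg //; field; rewrite Q0 R0 S0.
Qed.

(** If [P / Q] and [R / S] both express [f], then [(P S - R Q) Q S] vanishes on all of [A]: the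
    factor [Q S] takes care of the points where one of the expressions fails. A tangent vector
    annihilates this polynomial, and since [P S = R Q] at [p], only the derivative of [P S - R Q] is
    left. *)
Lemma deriv_at_uniq V (A : set V) p X f a b : A p -> tangent_space A p X ->
  deriv_at A p X f a -> deriv_at A p X f b -> a = b.
Proof.
move=> Ap tX [P [Q [dP [dQ [[hP hQ] Q0 hf [dP' dQ'] ->]]]]].
move=> [R [S [dR [dS [[hR hS] S0 hg [dR' dS'] ->]]]]].
have e : P p * S p = R p * Q p.
  have := hf _ Ap Q0; rewrite hg // => /eqP.
  by rewrite eqr_div // => /eqP.
have hN : polyfun (fun x => (P x * S x + (fun=> -1) x * (R x * Q x)) * (Q x * S x)).
  by repeat (first [apply: polyfun_mul|apply: polyfun_add|apply: polyfun_const|by []]).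
have /= := tX _ hN.
have hder := poly_derivM (poly_derivD (poly_derivM dP' dS')
  (poly_derivM (poly_deriv_const (-1) p X) (poly_derivM dR' dQ')))
  (poly_derivM dQ' dS').
have hN0 x : A x -> (P x * S x + -1 * (R x * Q x)) * (Q x * S x) = 0.
  move=> Ax.
  rewrite mulN1r; case: (eqVneq (Q x) 0) => [->|Qx]; first by rewrite mul0r mulr0.
  case: (eqVneq (S x) 0) => [->|Sx]; first by rewrite !mulr0.
  have := hf _ Ax Qx; rewrite hg // => /eqP.
  by rewrite eqr_div // => /eqP ->; rewrite subrr mul0r.
move=> /(_ hN0)/(poly_derivU hder).
rewrite /= -e !mulN1r subrr !mul0r addr0 => /eqP.
rewrite mulf_eq0 (negPf (mulf_neq0 Q0 S0)) orbF => /eqP E.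
apply/eqP; rewrite eqr_div ?expf_neq0 //; apply/eqP.
apply/eqP; rewrite -subr_eq0; apply/eqP.
(* The cross-multiplied difference of the two quotients is [Q S] times the derivative of
   [P S - R Q], up to a multiple of [P S - R Q], which is zero at [p]. *)
transitivity (Q p * S p * (dP * S p + P p * dS - (dR * Q p + R p * dQ))
  + (P p * S p - R p * Q p) * (- dS * Q p - dQ * S p)).
  by ring.
rewrite e subrr mul0r addr0; rewrite -[RHS](mulr0 (Q p * S p)) -{}E; ring.
Qed.

(** Along the zero vector every polynomial has derivative 0, so the derivative data reduce to the
    bare local expression. Closure of regular functions under sums, products, inverses and
    composition is thus the calculus of [deriv_at] with [X = 0]. *)
Lemma regular_onP V (A : set V) f :
  regular_on A f <-> forall p, A p -> deriv_at A p 0 f 0.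
Proof.
split=> [H p Ap|H p Ap].
  have [P [Q [hP hQ Q0 hf]]] := H p Ap.
  exists P, Q, 0, 0; split=> //; first by split; apply: poly_deriv0.
  by rewrite mul0r mulr0 subrr mul0r.
by have [P [Q [dP [dQ [[hP hQ] Q0 hf _ _]]]]] := H p Ap; exists P, Q; split.
Qed.

Lemma regular_deriv V (A : set V) f p X :
  regular_on A f -> A p -> exists d, deriv_at A p X f d.
Proof.
move=> H Ap; have [P [Q [hP hQ Q0 hf]]] := H p Ap.
have [dP dP'] := poly_deriv_ex p X hP; have [dQ dQ'] := poly_deriv_ex p X hQ.
by eexists; exists P, Q, dP, dQ; split.
Qed.

Lemma is_differentialE V W (A : set V) (phi : V -> W) p X Y :
  is_differential A phi p X Y <->
  forall l : {scalar W}, deriv_at A p X (fun x => l (phi x)) (l Y).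
Proof. by []. Qed.

Lemma polyfun_chain V W (A : set V) (phi : V -> W) p X Y P d :
  A p -> is_differential A phi p X Y -> polyfun P -> poly_deriv P (phi p) Y d ->
  deriv_at A p X (fun x => P (phi x)) d.
Proof.
move=> Ap H hP; elim: hP d => [c|l|{}P Q hP iP hQ iQ|{}P Q hP iP hQ iQ] d Hd.
- by rewrite (poly_derivU Hd (poly_deriv_const _ _ _)); apply: deriv_at_cst.
- by rewrite (poly_derivU Hd (poly_deriv_linear _ _ _)); apply: H.
- have [a Ha] := poly_deriv_ex (phi p) Y hP; have [b Hb] := poly_deriv_ex (phi p) Y hQ.
  rewrite (poly_derivU Hd (poly_derivD Ha Hb)).
  by apply: deriv_atD; [apply: iP|apply: iQ].
- have [a Ha] := poly_deriv_ex (phi p) Y hP; have [b Hb] := poly_deriv_ex (phi p) Y hQ.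
  rewrite (poly_derivU Hd (poly_derivM Ha Hb)).
  by apply: (deriv_atM Ap); [apply: iP|apply: iQ].
Qed.

Lemma deriv_at_chain V W (A : set V) (B : set W) (phi : V -> W) p X Y f d :
  A p -> (forall a, A a -> B (phi a)) -> is_differential A phi p X Y ->
  deriv_at B (phi p) Y f d -> deriv_at A p X (fun x => f (phi x)) d.
Proof.
move=> Ap AB H [P [Q [dP [dQ [[hP hQ] Q0 hf [dP' dQ'] ->]]]]].
apply: (@deriv_at_div _ _ _ _ (P \o phi) (Q \o phi)) => //=.
- by move=> x Ax Qx; rewrite hf //; apply: AB.
- exact: polyfun_chain dP'.
- exact: polyfun_chain dQ'.
Qed.

(** A polynomial vanishing on [B] pulls back to the zero function on [A], and the derivative of the
    latter along a tangent vector is unique. *)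
Lemma tangent_space_differential V W (A : set V) (B : set W) (phi : V -> W) p X Y :
  A p -> (forall a, A a -> B (phi a)) -> is_differential A phi p X Y ->
  tangent_space A p X -> tangent_space B (phi p) Y.
Proof.
move=> Ap AB H tX P hP P0; have [d Hd] := poly_deriv_ex (phi p) Y hP.
have h := polyfun_chain Ap H hP Hd.
suff -> : 0 = d by [].
apply: (deriv_at_uniq Ap tX _ h).
apply: (deriv_at_ext _ _ (deriv_at_cst A p X 0)) => // a Aa.
by rewrite P0 //; apply: AB.
Qed.

Lemma tangent_spaceS V (A B : set V) p X :
  A `<=` B -> tangent_space A p X -> tangent_space B p X.
Proof. by move=> AB tX P hP P0; apply: tX => // a /AB; apply: P0. Qed.

Lemma morphism_differential0 V W (A : set V) (B : set W) phi p :
  is_morphism A B phi -> A p -> is_differential A phi p 0 0.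
Proof.
move=> [_ H] Ap l; rewrite -/(deriv_at _ _ _ _ _) raddf0.
by have /regular_onP := H l; apply.
Qed.

Lemma regular_comp V W (A : set V) (B : set W) phi f :
  is_morphism A B phi -> regular_on B f -> regular_on A (fun x => f (phi x)).
Proof.
move=> hphi /regular_onP hf; apply/regular_onP => p Ap.
apply: (deriv_at_chain Ap hphi.1 (morphism_differential0 hphi Ap)).
exact/hf/hphi.1.
Qed.

Lemma regular_onS V (A B : set V) f : A `<=` B -> regular_on B f -> regular_on A f.
Proof.
move=> AB H p Ap; have [P [Q [hP hQ Q0 hf]]] := H p (AB _ Ap).
by exists P, Q; split=> // x /AB; apply: hf.
Qed.

Lemma regular_ext V (A : set V) f g :
  (forall a, A a -> f a = g a) -> regular_on A f -> regular_on A g.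
Proof.
move=> fg H p Ap; have [P [Q [hP hQ Q0 hf]]] := H p Ap.
by exists P, Q; split=> // x Ax Qx; rewrite -fg // hf.
Qed.

Lemma regular_polyfun V (A : set V) P : polyfun P -> regular_on A P.
Proof.
move=> hP p _; exists P, (fun=> 1); split=> //; first exact: polyfun_const.
  exact: oner_neq0.
by move=> *; rewrite divr1.
Qed.

Lemma regular_cst V (A : set V) c : regular_on A (fun=> c).
Proof. exact/regular_polyfun/polyfun_const. Qed.

Lemma regular_linear V (A : set V) (l : {scalar V}) : regular_on A l.
Proof. exact/regular_polyfun/polyfun_linear. Qed.

Lemma regularD V (A : set V) f g :
  regular_on A f -> regular_on A g -> regular_on A (fun x => f x + g x).
Proof.
move=> /regular_onP hf /regular_onP hg; apply/regular_onP => p Ap.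
by rewrite -[0 in X in deriv_at _ _ _ _ X]addr0; apply: deriv_atD; [apply: hf|apply: hg].
Qed.

Lemma regularM V (A : set V) f g :
  regular_on A f -> regular_on A g -> regular_on A (fun x => f x * g x).
Proof.
move=> /regular_onP hf /regular_onP hg; apply/regular_onP => p Ap.
by have := deriv_atM Ap (hf _ Ap) (hg _ Ap); rewrite mul0r mulr0 addr0.
Qed.

Lemma regularV V (A : set V) f :
  (forall a, A a -> f a != 0) -> regular_on A f -> regular_on A (fun x => (f x)^-1).
Proof.
move=> f0 /regular_onP hf; apply/regular_onP => p Ap.
have := @deriv_at_div _ A p 0 (fun=> 1) f (fun x => (f x)^-1) 0 0 Ap (f0 _ Ap).
rewrite mul0r mulr0 subrr mul0r; apply; last exact: hf.
  by move=> *; rewrite div1r.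
exact: deriv_at_cst.
Qed.

Lemma regular_sum V (A : set V) (J : Type) (r : seq J) (F : J -> V -> K) :
  (forall j, regular_on A (F j)) -> regular_on A (fun x => \sum_(j <- r) F j x).
Proof.
move=> H; elim: r => [|j r IH].
  by apply: (regular_ext _ (regular_cst 0)) => a _; rewrite big_nil.
by apply: (regular_ext _ (regularD (H j) IH)) => a _; rewrite big_cons.
Qed.

Lemma regular_prod V (A : set V) (J : Type) (r : seq J) (F : J -> V -> K) :
  (forall j, regular_on A (F j)) -> regular_on A (fun x => \prod_(j <- r) F j x).
Proof.
move=> H; elim: r => [|j r IH].
  by apply: (regular_ext _ (regular_cst 1)) => a _; rewrite big_nil.
by apply: (regular_ext _ (regularM (H j) IH)) => a _; rewrite big_cons.
Qed.

Lemma deriv_at_sum V (A : set V) p X (J : Type) (r : seq J) (F : J -> V -> K) d :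
  (forall j, deriv_at A p X (F j) (d j)) ->
  deriv_at A p X (fun x => \sum_(j <- r) F j x) (\sum_(j <- r) d j).
Proof.
move=> H; elim: r => [|j r IH].
  by rewrite big_nil; apply: (deriv_at_ext _ _ (deriv_at_cst A p X 0)) => // a _;
    rewrite big_nil.
by rewrite big_cons; apply: (deriv_at_ext _ _ (deriv_atD (H j) IH)) => // a _;
  rewrite big_cons.
Qed.

Lemma morphism_comp U V W (A : set U) (B : set V) (C : set W) phi psi :
  is_morphism A B phi -> is_morphism B C psi -> is_morphism A C (psi \o phi).
Proof.
move=> h1 h2; split=> [x Ax|l]; first exact/h2.1/h1.1.
exact: (regular_comp h1 (h2.2 l)).
Qed.

Lemma morphismS V W (A A' : set V) (B B' : set W) phi : A' `<=` A ->
  (forall x, A' x -> B' (phi x)) -> is_morphism A B phi -> is_morphism A' B' phi.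
Proof. by move=> AA' h [_ H]; split=> // l; apply: (regular_onS _ (H l)). Qed.

Lemma morphism_ext V W (A : set V) (B : set W) phi psi :
  (forall x, A x -> phi x = psi x) -> is_morphism A B phi -> is_morphism A B psi.
Proof.
move=> e [h H]; split=> [x Ax|l]; first by rewrite -e //; apply: h.
by apply: (regular_ext _ (H l)) => a Aa; rewrite e.
Qed.

End Derivatives.

(** * Morphisms from the line and density *)

Section Curves.
Context {K : numFieldType}.
Implicit Types (U V W : lmodType K).

Lemma scalar_linear V (h : V -> K) : scalar h -> exists l : {scalar V}, l = h :> (V -> K).
Proof.
move=> hs.
pose l : {scalar V} := HB.pack h (GRing.isLinear.Build K V K *%R h hs).
by exists l.
Qed.

Lemma regular_scalar V W (A : set V) (B : set W) phi (h : W -> K) :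
  scalar h -> is_morphism A B phi -> regular_on A (fun x => h (phi x)).
Proof. by move=> /scalar_linear[l <-] [_]; apply. Qed.

Lemma deriv_at_scalar V W (A : set V) (phi : V -> W) p X Y (h : W -> K) :
  scalar h -> is_differential A phi p X Y -> deriv_at A p X (fun x => h (phi x)) (h Y).
Proof. by move=> /scalar_linear[l <-]; apply. Qed.

Lemma regular_scalar_id V (A : set V) (h : V -> K) : scalar h -> regular_on A h.
Proof. by move=> /scalar_linear[l <-]; apply: regular_linear. Qed.

Lemma scalarKo (b : K) : scalar (fun x : K^o => (x : K) * b).
Proof. by move=> a x y; rewrite mulrDl -mulrA. Qed.

Lemma scalarKo_id : scalar (fun x : K^o => (x : K)).
Proof. by []. Qed.

Lemma scalarKoE (l : {scalar K^o}) x : l x = (x : K) * l 1.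
Proof. by rewrite -[x in LHS]mulr1 -[x * 1]/(x *: (1 : K^o)) linearZ. Qed.

Lemma morphism_Ko V (A : set V) (B : set K^o) (f : V -> K^o) :
  (forall x, A x -> B (f x)) -> regular_on A (f : V -> K) -> is_morphism A B f.
Proof.
move=> h H; split=> // l.
by apply: (regular_ext _ (regularM H (regular_cst (l 1)))) => x _; rewrite [RHS]scalarKoE.
Qed.

Lemma regular_Ko V (A : set V) (B : set K^o) (f : V -> K^o) :
  is_morphism A B f -> regular_on A (f : V -> K).
Proof. exact: regular_scalar scalarKo_id. Qed.

Lemma is_differential_Ko V (A : set V) (f : V -> K^o) p X (d : K) :
  deriv_at A p X (f : V -> K) d -> A p -> is_differential A f p X (d : K^o).
Proof.
move=> H Ap; apply/is_differentialE => l.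
have := deriv_atM Ap H (deriv_at_cst A p X (l 1)).
rewrite mulr0 addr0 -scalarKoE; apply: deriv_at_ext => // a _.
by rewrite [RHS]scalarKoE.
Qed.

Section Vect.
Context {V : lmodType K} {W : vectType K}.

Lemma vect_scalarE (l : {scalar W}) w :
  l w = \sum_i coord (vbasis fullv) i w * l (vbasis fullv)`_i.
Proof.
rewrite {1}(coord_vbasis (memvf w)) linear_sum; apply: eq_bigr => i _.
by rewrite linearZ.
Qed.

Lemma vect_separate (w1 w2 : W) : (forall l : {scalar W}, l w1 = l w2) -> w1 = w2.
Proof.
move=> H; rewrite (coord_vbasis (memvf w1)) (coord_vbasis (memvf w2)).
by apply: eq_bigr => i _; rewrite H.
Qed.

Lemma is_differential_ex (A : set V) (B : set W) (phi : V -> W) p X :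
  is_morphism A B phi -> A p -> exists Y, is_differential A phi p X Y.
Proof.
move=> [_ H] Ap.
have /(_ _)/cid-h := fun i => regular_deriv X (H (coord (vbasis fullv) i)) Ap.
pose Y : W := \sum_i sval (h i) *: (vbasis fullv)`_i.
exists Y; apply/is_differentialE => l.
rewrite linear_sum; apply: deriv_at_ext; last first.
- apply: (@deriv_at_sum _ _ A p X _ _ (fun i x => coord (vbasis fullv) i (phi x) * l
    (vbasis fullv)`_i)).
  move=> i; rewrite linearZ /=.
  have := deriv_atM Ap (svalP (h i)) (deriv_at_cst A p X (l (vbasis fullv)`_i)).
  by rewrite mulr0 addr0.
- by move=> a _; rewrite [RHS]vect_scalarE.
- by [].
Qed.

Lemma differentialP (A : set V) (B : set W) (phi : V -> W) p X :
  is_morphism A B phi -> A p -> is_differential A phi p X (differential A phi p X).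
Proof. by move=> h Ap; apply: (xgetPex 0 (is_differential_ex X h Ap)). Qed.

End Vect.

(** * Matrix-valued maps, differentiated entry by entry *)

Section Matrices.
Context {n : nat}.
Local Notation M := 'M[K]_n.

Lemma mx_scalarE (l : {scalar M}) A : l A = \sum_i \sum_j A i j * l (delta_mx i j).
Proof.
rewrite {1}(matrix_sum_delta A) linear_sum; apply: eq_bigr => i _.
by rewrite linear_sum; apply: eq_bigr => j _; rewrite linearZ.
Qed.

Lemma scalar_entry i j : scalar (fun A : M => A i j).
Proof. by move=> a x y; rewrite !mxE. Qed.

Lemma is_differential_mx V (A : set V) (phi : V -> M) p X (Y : M) : A p ->
  (forall i j, deriv_at A p X (fun x => phi x i j) (Y i j)) ->
  is_differential A phi p X Y.
Proof.
move=> Ap H; apply/is_differentialE => l; rewrite (mx_scalarE l Y).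
apply: deriv_at_ext; last first.
- apply: (@deriv_at_sum _ _ A p X _ _ (fun i x => \sum_j phi x i j * l (delta_mx i
    j))) => i.
  apply: (@deriv_at_sum _ _ A p X _ _ (fun j x => phi x i j * l (delta_mx i j))) => j.
  have := deriv_atM Ap (H i j) (deriv_at_cst A p X (l (delta_mx i j))).
  by rewrite mulr0 addr0.
- by move=> a _; rewrite [RHS]mx_scalarE.
- by [].
Qed.

Lemma is_differential_mx_uniq V (A : set V) (phi : V -> M) p X Y Z :
  A p -> tangent_space A p X ->
  is_differential A phi p X Y -> is_differential A phi p X Z -> Y = Z.
Proof.
move=> Ap tX hY hZ; apply/matrixP => i j.
apply: (deriv_at_uniq Ap tX (deriv_at_scalar (scalar_entry i j) hY)
  (deriv_at_scalar (scalar_entry i j) hZ)).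
Qed.

Lemma is_differential_mulmx V (A : set V) (phi psi : V -> M) p X (Y Z : M) : A p ->
  is_differential A phi p X Y -> is_differential A psi p X Z ->
  is_differential A (fun x => phi x *m psi x) p X (Y *m psi p + phi p *m Z).
Proof.
move=> Ap hY hZ; apply: is_differential_mx => // i j.
have -> : (Y *m psi p + phi p *m Z) i j =
    \sum_k (Y i k * psi p k j + phi p i k * Z k j).
  by rewrite big_split !mxE.
apply: deriv_at_ext; last first.
- apply: (@deriv_at_sum _ _ A p X _ _ (fun k x => phi x i k * psi x k j)) => k.
  exact: (deriv_atM Ap (deriv_at_scalar (scalar_entry _ _) hY)
    (deriv_at_scalar (scalar_entry _ _) hZ)).
- by move=> a _; rewrite mxE.
- by [].
Qed.

Lemma is_differential_cst V W (A : set V) (c : W) p X :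
  is_differential A (fun=> c) p X 0.
Proof. by apply/is_differentialE => l; rewrite raddf0; apply: deriv_at_cst. Qed.

Lemma morphism_mx V (A : set V) (B : set M) phi :
  (forall x, A x -> B (phi x)) -> (forall i j, regular_on A (fun x => phi x i j)) ->
  is_morphism A B phi.
Proof.
move=> h H; split=> // l.
have := @regular_sum _ _ A _ (index_enum _) (fun i x => \sum_j phi x i j * l
  (delta_mx i j)).
move=> R; apply: (regular_ext _ (R _)) => [x _|i]; first by rewrite [RHS]mx_scalarE.
apply: (@regular_sum _ _ A _ (index_enum _) (fun j x => phi x i j * l (delta_mx i j))) => j.
exact: regularM (H i j) (regular_cst _).
Qed.

Lemma morphism_mulmx V (A : set V) (B1 B2 B : set M) phi psi :
  (forall x, A x -> B (phi x *m psi x)) ->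
  is_morphism A B1 phi -> is_morphism A B2 psi ->
  is_morphism A B (fun x => phi x *m psi x).
Proof.
move=> h H1 H2; apply: morphism_mx => // i j.
have := @regular_sum _ _ A _ (index_enum _) (fun k x => phi x i k * psi x k j).
move=> R; apply: (regular_ext _ (R _)) => [x _|k]; first by rewrite mxE.
by apply: regularM; [exact: (regular_scalar (scalar_entry i k) H1)
  |exact: (regular_scalar (scalar_entry k j) H2)].
Qed.

Lemma morphism_cst V W (A : set V) (B : set W) c : B c -> is_morphism A B (fun=> c).
Proof. by move=> Bc; split=> // l; apply: regular_cst. Qed.

End Matrices.

Lemma horner_polyfun (q : {poly K}) :
  polyfun (fun x : K^o => q.[x]) /\
  forall c, poly_deriv (fun x : K^o => q.[x]) c 1 q^`().[c].
Proof.
elim/poly_ind: q => [|q a [IH1 IH2]].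
  have -> : (fun x : K^o => (0 : {poly K}).[x]) = (fun=> 0).
    by apply/funext => x; rewrite horner0.
  split; first exact: polyfun_const.
  by move=> c; rewrite linear0 horner0; apply: poly_deriv_const.
have [l hl] := scalar_linear scalarKo_id.
have -> : (fun x : K^o => (q * 'X + a%:P).[x]) =
    (fun x => q.[x] * l x + (fun=> a) x).
  by apply/funext => x; rewrite hornerD hornerM hornerX hornerC hl.
split.
  by apply: polyfun_add; [apply: polyfun_mul => //; apply: polyfun_linear|apply:
    polyfun_const].
move=> c; have := poly_derivD (poly_derivM (IH2 c) (poly_deriv_linear l c 1))
  (poly_deriv_const a c 1).
rewrite derivD derivM derivX derivC addr0 mulr1 addr0 hornerD hornerM hornerX.
by rewrite !hl mulr1.
Qed.

Lemma polyfun_Ko (P : K^o -> K) : polyfun P -> exists q : {poly K}, forall c, P c = q.[c].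
Proof.
move=> hP; have [d [q hq _]] := poly_deriv_ex 0 1 hP.
by exists q => c; rewrite -hq add0r -[c *: _]/(c * 1) mulr1.
Qed.

Lemma regular_line (A : set K^o) (f : K^o -> K) a : regular_on A f -> A a ->
  exists P Q : {poly K}, Q.[a] != 0 /\
    forall c, A c -> Q.[c] != 0 -> f c = P.[c] / Q.[c].
Proof.
move=> H /H[P [Q [/polyfun_Ko[p hp] /polyfun_Ko[q hq] Q0 h]]].
by exists p, q; rewrite -hq; split=> // c Ac; rewrite -hq -hp; apply: h.
Qed.

(** * Regular functions on a cofinite subset of the line: the affine line for [r = 1], Gm for
    [r = 'X] *)

Section CofiniteLine.
Variables (A : set K^o) (r : {poly K}).
Hypotheses (r0 : r != 0) (rA : forall c, r.[c] != 0 -> A c).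

(** A polynomial vanishing on [A] vanishes everywhere after multiplication by [r], so it is zero.
    Hence no vector is excluded and [deriv_at_uniq] always applies on [A]. *)
Lemma tangent_line p X : tangent_space A p X.
Proof.
move=> P hP P0; have [q hq] := polyfun_Ko hP.
suff q0 : q = 0.
  exists 0; last by rewrite coef0.
  by move=> t; rewrite hq q0 !horner0.
apply/eqP/negPn/negP => q0.
have /poly_nonroot[c] : q * r != 0 by rewrite mulf_neq0.
by rewrite hornerM mulf_eq0 -hq negb_or => /andP[/eqP + /rA/P0].
Qed.

Lemma deriv_line f c d : A c -> deriv_at A c 1 f d -> forall P Q : {poly K},
  Q.[c] != 0 -> (forall c, A c -> Q.[c] != 0 -> f c = P.[c] / Q.[c]) ->
  d = (P^`().[c] * Q.[c] - P.[c] * Q^`().[c]) / Q.[c] ^+ 2.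
Proof.
move=> Ac hd P Q Q0 h; apply: (deriv_at_uniq Ac (tangent_line c 1) hd).
have [P1 P2] := horner_polyfun P; have [Q1 Q2] := horner_polyfun Q.
by exists (fun x => P.[x]), (fun x => Q.[x]), P^`().[c], Q^`().[c]; split.
Qed.

(** Otherwise [P] is [(X - c)^(m+1) S] with [S] nonzero at [c]. Cancelling [(X - c)^m] and
    evaluating at [c] leaves [(m+1) S(c) Q(c) = 0], impossible in characteristic zero. *)
Lemma wronskian0 (P Q : {poly K}) c : P^`() * Q = P * Q^`() -> Q.[c] != 0 ->
  P.[c] = 0 -> P = 0.
Proof.
move=> E Q0 P0; apply/eqP/negPn/negP => Pn0.
have [m [S]] := multiplicity_XsubC P c.
rewrite Pn0 /= => S0 eP.
case: m eP => [|m] eP; first by move: S0; rewrite rootE -[S]mulr1 -[1]/(('X - c%:P)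
  ^+ 0) -eP P0 eqxx.
set x := ('X - c%:P) in eP.
have x0 : x ^+ m != 0 by rewrite expf_neq0 // polyXsubC_eq0.
have : x ^+ m * ((S^`() * x + S *+ m.+1) * Q - S * x * Q^`()) = 0.
  move: E; rewrite eP derivM deriv_exp derivXsubC mul1r exprS => /eqP.
  rewrite -subr_eq0 => /eqP <-; rewrite /=; ring.
move=> /eqP; rewrite mulf_eq0 (negPf x0) /= => /eqP/(congr1 (horner^~ c)).
rewrite /x !hornerE subrr !(mulr0, mul0r) add0r subr0 => /eqP.
rewrite mulf_eq0 (negPf Q0) orbF hornerMn -mulr_natl mulf_eq0 pnatr_eq0 /=.
by apply/negP.
Qed.

(** With [f = P / Q] near [a] and [k = f a], the Wronskian of [P] and [Q] vanishes on a cofinite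
    set, hence identically. The polynomial [P - k Q] has the same Wronskian with [Q] and a zero at
    [a], so it is zero. *)
Lemma deriv0_cst f : regular_on A f -> (forall c, A c -> deriv_at A c 1 f 0) ->
  forall a b, A a -> A b -> f a = f b.
Proof.
move=> hf hd a b Aa Ab.
have [P [Q [Q0 h]]] := regular_line hf Aa.
pose k := f a; pose S := P - k *: Q.
have W c : A c -> Q.[c] != 0 -> (P^`() * Q - P * Q^`()).[c] = 0.
  move=> Ac Qc; have /esym/eqP := deriv_line Ac (hd c Ac) Qc h.
  rewrite mulf_eq0 invr_eq0 expf_eq0 (negPf Qc) /= orbF => /eqP.
  by rewrite hornerD hornerN !hornerM.
have Qn0 : Q != 0 by apply: contra_neq Q0 => ->; rewrite horner0.
have W0 : P^`() * Q - P * Q^`() = 0.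
  apply/eqP/negPn/negP => n0.
  have /poly_nonroot[c] : (P^`() * Q - P * Q^`()) * (r * Q) != 0.
    by rewrite !mulf_neq0.
  rewrite hornerM mulf_eq0 negb_or => /andP[/eqP + +].
  by rewrite hornerM mulf_eq0 negb_or => + /andP[/rA Ac Qc]; apply; apply: W.
have S0 : S = 0.
  apply: (@wronskian0 _ Q a) => //.
    apply/eqP; rewrite -subr_eq0 -W0 /S derivB derivZ; apply/eqP.
    by rewrite -!mul_polyC; ring.
  by rewrite /S !hornerE /k h // divfK // subrr.
(* The expression near [a] may be undefined at [b]. A second one, valid near [b], takes the value
   [k] wherever [r Q Q1] is nonzero, which forces [P1 = k Q1]. *)
have [P1 [Q1 [Q10 h1]]] := regular_line hf Ab.
have Q1n0 : Q1 != 0 by apply: contra_neq Q10 => ->; rewrite horner0.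
have : P1 - k *: Q1 = 0.
  apply/eqP/negPn/negP => n0.
  have /poly_nonroot[c] : (P1 - k *: Q1) * (r * (Q * Q1)) != 0.
    by rewrite !mulf_neq0.
  rewrite hornerM mulf_eq0 negb_or => /andP[/eqP + +].
  rewrite hornerM mulf_eq0 negb_or => + /andP[/rA Ac].
  rewrite hornerM mulf_eq0 negb_or => + /andP[Qc Q1c]; apply.
  have := h1 _ Ac Q1c; rewrite h //.
  have -> : P = k *: Q by apply/eqP; rewrite -subr_eq0 -/S S0.
  rewrite !hornerE mulfK // => ->; rewrite divfK // subrr //.
move=> /(congr1 (horner^~ b)); rewrite !hornerE => /eqP; rewrite subr_eq0 => /eqP e.
by rewrite [f b]h1 // e mulfK.
Qed.

End CofiniteLine.

Lemma regular_line_neq0 (f : K^o -> K) a : regular_on setT f -> f a != 0 ->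
  exists2 q : {poly K}, q != 0 & forall c, q.[c] != 0 -> f c != 0.
Proof.
move=> hf fa; have [P [Q [Q0 h]]] := regular_line hf (I : setT a).
exists (P * Q).
  move: fa; rewrite h // mulf_eq0 negb_or => /andP[P0 _].
  by rewrite mulf_neq0 //; [apply: contra_neq P0|apply: contra_neq Q0] => ->; rewrite
    horner0.
by move=> c; rewrite hornerM mulf_eq0 negb_or => /andP[Pc Qc]; rewrite h // mulf_neq0
  ?invr_eq0.
Qed.

(** A substitute for irreducibility that is easy to verify for groups generated by root subgroups.
    Regular functions that are not identically zero on [X] restrict to a suitable line with only
    finitely many zeros, so finitely many of them are nonzero at a common point. *)
Definition line_connected V (X : set V) : Prop := forall a b, X a -> X b ->
  exists2 g : K^o -> V, is_morphism setT X g & g 0 = a /\ g 1 = b.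

Lemma line_connected_neq0 V (X : set V) (f h : V -> K) a b : line_connected X ->
  regular_on X f -> regular_on X h -> X a -> X b -> f a != 0 -> h b != 0 ->
  exists c, [/\ X c, f c != 0 & h c != 0].
Proof.
move=> LX hf hh Xa Xb fa hb; have [g hg [g0 g1]] := LX a b Xa Xb.
rewrite -g0 in fa; rewrite -g1 in hb.
have [q q0 hq] := regular_line_neq0 (regular_comp hg hf) fa.
have [s s0 hs] := regular_line_neq0 (regular_comp hg hh) hb.
have /poly_nonroot[c] : q * s != 0 by rewrite mulf_neq0.
rewrite hornerM mulf_eq0 negb_or => /andP[/hq qc /hs sc].
by exists (g c); split => //; apply: hg.1.
Qed.

Lemma line_connected_all_neq0 V (X : set V) (J : eqType) (s : seq J) (f : J -> V -> K) :
  line_connected X -> X !=set0 -> (forall j, regular_on X (f j)) ->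
  (forall j, exists2 a, X a & f j a != 0) -> exists2 a, X a & forall j, j \in s -> f
    j a != 0.
Proof.
move=> LX [x Xx] hf H; suff [a Xa Pa] : exists2 a, X a & \prod_(j <- s) f j a != 0.
  by exists a => // j js; apply: contra_neq Pa => fj; apply/eqP; rewrite
    prodf_seq_eq0; apply/hasP; exists j; rewrite //= fj.
elim: s => [|j s [a Xa Pa]]; first by exists x => //; rewrite big_nil oner_neq0.
have [b Xb fb] := H j.
have [c [Xc Pc fc]] := line_connected_neq0 LX (regular_prod s hf) (hf j) Xa Xb Pa fb.
by exists c => //; rewrite big_cons mulf_neq0.
Qed.

(** Suppose [P] vanishes on the open set but not on [X]. Some [P0] among the equations of the
    complement is nonzero at a point of [X], so [P0] and [P] are both nonzero at some point of [X];
    that point lies in the open set, a contradiction. *)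
Lemma zdense_line_connected V (X O : set V) : line_connected X -> zopen_in X O ->
  O !=set0 -> zdense_in X O.
Proof.
move=> LX [Z0 [S0 hS0 ->] ->] [o [Xo Zo]] Z [S hS ->] OZ x Xx P SP.
apply: contrapT => /eqP Px; apply: Zo => P0 SP0.
apply: contrapT => /eqP P0o.
have [c [Xc P0c Pc]] := line_connected_neq0 LX
  (regular_polyfun (hS0 _ SP0)) (regular_polyfun (hS _ SP)) Xo Xx P0o Px.
suff /OZ/(_ _ SP)/eqP : (X `\` [set x | forall P, S0 P -> P x = 0]) c by rewrite (negPf Pc).
by split=> // /(_ _ SP0)/eqP; rewrite (negPf P0c).
Qed.

(** * Zariski-open sets and regular maps *)

Lemma zclosedU V (Z1 Z2 : set V) : zclosed Z1 -> zclosed Z2 -> zclosed (Z1 `|` Z2).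
Proof.
move=> [S1 h1 ->] [S2 h2 ->].
exists [set f | exists P Q, [/\ S1 P, S2 Q & f = (fun x => P x * Q x)]].
  by move=> f [P [Q [/h1 hP /h2 hQ ->]]]; apply: polyfun_mul.
apply/seteqP; split=> [x [H|H] f [P [Q [SP SQ ->]]]|x H].
- by rewrite H // mul0r.
- by rewrite [Q x]H // mulr0.
- case: (pselect (forall P, S1 P -> P x = 0)) => [?|/existsNP[P /not_implyP[SP Px]]];
    first by left.
  right=> Q SQ; have /eqP := H (fun x => P x * Q x) (ex_intro _ P (ex_intro _ Q (And3
    SP SQ erefl))).
  by rewrite mulf_eq0 => /orP[/eqP|/eqP//].
Qed.

(** No single quotient need express [f] on all of [X], so the equations are the products [P Q] over
    all local expressions [P / Q]. Each vanishes where [f] does, and at a given point some [Q] is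
    nonzero. *)
Lemma regular_zero_closed V (X : set V) f : regular_on X f ->
  exists2 Z, zclosed Z & forall x, X x -> Z x <-> f x = 0.
Proof.
move=> hf.
pose S : set (V -> K) := [set N | exists P Q, [/\ polyfun P, polyfun Q,
  forall x, X x -> Q x != 0 -> f x = P x / Q x & N = (fun x => P x * Q x)]].
exists [set x | forall N, S N -> N x = 0].
  by exists S => // N [P [Q [hP hQ _ ->]]]; apply: polyfun_mul.
move=> x Xx; split=> [H|fx N [P [Q [_ _ h ->]]]].
  have [P [Q [hP hQ Q0 h]]] := hf x Xx.
  have /eqP := H (fun x => P x * Q x) (ex_intro _ P (ex_intro _ Q (And4 hP hQ h erefl))).
  by rewrite mulf_eq0 (negPf Q0) orbF h // => /eqP ->; rewrite mul0r.
case: (eqVneq (Q x) 0) => [->|Qx]; first by rewrite mulr0.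
move: fx; rewrite h // => /eqP; rewrite mulf_eq0 invr_eq0 (negPf Qx) orbF => /eqP ->.
by rewrite mul0r.
Qed.

Lemma zopen_regular_neq0 V (X : set V) (J : finType) (f : J -> V -> K) :
  (forall j, regular_on X (f j)) ->
  zopen_in X [set x | X x /\ forall j, f j x != 0].
Proof.
move=> hf; have [Z hZ ZP] := regular_zero_closed (regular_prod (index_enum J) hf).
exists Z => //; apply/seteqP; split=> x [Xx].
  move=> H; split=> // /(ZP _ Xx)/eqP.
  by rewrite prodf_seq_eq0 => /hasP[j _ /=]; rewrite (negPf (H j)).
move=> nZ; split=> // j; apply/eqP => fj; apply: nZ; apply/(ZP _ Xx).
by rewrite (bigD1 j) //= fj mul0r.
Qed.

Lemma zopen_inI V (X O1 O2 : set V) :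
  zopen_in X O1 -> zopen_in X O2 -> zopen_in X (O1 `&` O2).
Proof.
move=> [Z1 h1 ->] [Z2 h2 ->]; exists (Z1 `|` Z2); first exact: zclosedU.
by apply/seteqP; split=> x; rewrite /= ; tauto.
Qed.

Lemma zopen_preimage V W (X : set V) (Y O : set W) phi :
  is_morphism X Y phi -> zopen_in Y O -> zopen_in X (X `&` phi @^-1` O).
Proof.
move=> hphi [Z [S hS ->] ->].
have /(_ _ _)/cid2-H := fun P (SP : S P) => regular_zero_closed (regular_comp hphi
  (regular_polyfun (hS P SP))).
(* Each equation [P] of [Z] pulls back to a merely regular function, whose zero set comes from a
   closed set [s2val (H P SP)]. [T] gathers the polynomials vanishing on one of these, so it cuts
   out their intersection. *)
pose T : set (V -> K) := [set N | polyfun N /\ exists P (SP : S P), forall x, s2val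
  (H P SP) x -> N x = 0].
exists [set x | forall N, T N -> N x = 0]; first by exists T => // N [].
apply/seteqP; split=> x [Xx].
  move=> [Yx nZ]; split=> // HT; apply: nZ => P SP.
  apply/(s2valP' (H P SP) x Xx).
  have [S' hS' e] := s2valP (H P SP); rewrite e => N S'N; apply: HT; split; first
    exact: hS'.
  by exists P, SP => y; rewrite e; apply.
move=> nT; split=> //; split; first exact: hphi.1.
move=> HS; apply: nT => N [_ [P [SP h]]]; apply: h; apply/(s2valP' (H P SP) x Xx).
exact: HS.
Qed.

End Curves.

(** * Calculus on the additive and multiplicative groups *)

Section OneParameter.
Context {K : numFieldType}.
Implicit Types (U V W : lmodType K).

Lemma poly_derivZ V (P : V -> K) p X (a d : K) :
  poly_deriv P p X d -> poly_deriv P p (a *: X) (a * d).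
Proof.
move=> [q hq <-]; exists (\poly_(i < size q) (q`_i * a ^+ i)) => [t|].
  rewrite scalerA hq horner_poly horner_coef; apply: eq_bigr => i _.
  by rewrite exprMn mulrA mulrAC.
rewrite coef_poly expr1 mulrC; case: ltnP => // /(nth_default 0) ->.
by rewrite mulr0.
Qed.

Lemma deriv_atZ V (A : set V) p X f (a d : K) :
  deriv_at A p X f d -> deriv_at A p (a *: X) f (a * d).
Proof.
move=> [P [Q [dP [dQ [h1 h2 h3 [h4 h5] ->]]]]].
exists P, Q, (a * dP), (a * dQ); split=> //; first by split; apply: poly_derivZ.
by field.
Qed.

Lemma is_differentialZ V W (A : set V) (phi : V -> W) p X Y (a : K) :
  is_differential A phi p X Y -> is_differential A phi p (a *: X) (a *: Y).
Proof.
move=> H; apply/is_differentialE => l; rewrite linearZ; apply: deriv_atZ.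
exact: H.
Qed.

Lemma is_differential_ext V W (A : set V) (phi psi : V -> W) p X Y :
  (forall a, A a -> phi a = psi a) ->
  is_differential A phi p X Y -> is_differential A psi p X Y.
Proof.
move=> e H; apply/is_differentialE => l.
by apply: deriv_at_ext (H l) => // a Aa; rewrite e.
Qed.

Lemma is_differential_comp U V W (A : set U) (B : set V) (phi : U -> V)
    (psi : V -> W) p X Y Z :
  A p -> (forall a, A a -> B (phi a)) -> is_differential A phi p X Y ->
  is_differential B psi (phi p) Y Z -> is_differential A (psi \o phi) p X Z.
Proof.
move=> Ap AB H1 H2; apply/is_differentialE => l.
exact: (deriv_at_chain Ap AB H1 (H2 l)).
Qed.

Lemma is_differential_scale V W (A : set V) (f : V -> K) (phi : V -> W) p X d Y :
  A p -> deriv_at A p X f d -> is_differential A phi p X Y ->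
  is_differential A (fun x => f x *: phi x) p X (d *: phi p + f p *: Y).
Proof.
move=> Ap hf H; apply/is_differentialE => l; rewrite linearD !linearZ /=.
apply: deriv_at_ext (deriv_atM Ap hf (H l)) => // a _.
by rewrite linearZ.
Qed.

Lemma morphism_affine W (A : set K^o) (B : set W) (a b : W) :
  (forall c, A c -> B ((c : K) *: a + b)) ->
  is_morphism A B (fun c : K^o => (c : K) *: a + b).
Proof.
move=> h; split=> // l.
have := regularD (regular_scalar_id (scalarKo (l a))) (regular_cst (A := A) (l b)).
by apply: regular_ext => c _; rewrite linearD linearZ.
Qed.

Lemma deriv_at_Ko_id (A : set K^o) p X :
  deriv_at A p X (fun x => x : K) (X : K).
Proof.
by have [l hl] := scalar_linear (@scalarKo_id K); have := deriv_at_linear A p X l;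
  rewrite hl.
Qed.

(** The hypothesis concerns translates at 0, because for a one-parameter subgroup the group law
    reduces every derivative to the one at the identity. The substitution [t - c] carries it to the
    point [c]. *)
Lemma additive_cst (f : K^o -> K) : regular_on setT f ->
  (forall c : K, deriv_at setT 0 1 (fun s : K^o => f (s + c)) 0) ->
  forall a b, f a = f b.
Proof.
move=> hf H a b; apply: (@deriv0_cst K setT 1 (oner_neq0 _) _ f hf _ a b) => // c _.
have D : is_differential setT (fun t : K^o => (t - c : K^o)) c 1 1.
  apply: is_differential_Ko => //.
  have := deriv_atD (deriv_at_Ko_id setT c 1) (deriv_at_cst setT c 1 (- c : K)).
  by rewrite addr0.
have := @deriv_at_chain K _ _ setT setT (fun t : K^o => t - c : K^o) c 1 1
   (fun s : K^o => f (s + c)) 0 I (fun _ _ => I) D.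
rewrite subrr => /(_ (H c)); apply: deriv_at_ext => // x _.
by rewrite subrK.
Qed.

(** The analogue on Gm: the substitution [t / c] multiplies the derivative by [c^-1], which leaves 0
    unchanged. *)
Lemma multiplicative_cst (f : K^o -> K) : regular_on Gm f ->
  (forall c : K, c != 0 -> deriv_at Gm 1 1 (fun s : K^o => f (s * c)) 0) ->
  forall a b : K, a != 0 -> b != 0 -> f a = f b.
Proof.
move=> hf H a b; apply: (@deriv0_cst K Gm 'X (negbT (polyX_eq0 _)) _ f hf _ a b).
  by move=> c; rewrite hornerX.
move=> c c0.
have D : is_differential Gm (fun t : K^o => ((t : K) * c^-1 : K^o)) c 1 (c^-1 *: (1 : K^o)).
  apply: is_differential_Ko => //.
  have := deriv_atM c0 (deriv_at_Ko_id Gm c 1) (deriv_at_cst Gm c 1 (c^-1 : K)).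
  by rewrite mulr0 addr0 mul1r [c^-1 *: _]mulr1.
have := @deriv_at_chain K _ _ Gm Gm (fun t : K^o => (t : K) * c^-1 : K^o) c 1 _
   (fun s : K^o => f ((s : K) * c)) 0 c0 _ D.
rewrite mulfV // -[0](mulr0 (c^-1)) => /(_ _ (deriv_atZ _ (H _ c0))).
move=> h; apply: (deriv_at_ext _ _ (h _)) => //.
  by move=> x _; rewrite divfK.
by move=> x x0; rewrite /Gm /= mulf_neq0 ?invr_eq0.
Qed.

Lemma line_connectedX V W (X : set V) (Y : set W) :
  line_connected X -> line_connected Y -> line_connected (X `*` Y).
Proof.
move=> HX HY [a a'] [b b'] [/= Xa Ya'] [/= Xb Yb'].
have [g hg [g0 g1]] := HX a b Xa Xb; have [h hh [h0 h1]] := HY a' b' Ya' Yb'.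
exists (fun t => (g t, h t)); last by rewrite g0 g1 h0 h1.
split=> [t _|l]; first by split; [apply: hg.1|apply: hh.1].
have s1 : scalar (fun x => l (x, 0)).
  move=> k x y;
  have -> : (k *: x + y, 0) = k *: (x, 0) + (y, 0) :> V * W.
    by apply: injective_projections; rewrite /= ?scaler0 ?addr0.
  by rewrite linearP.
have s2 : scalar (fun y => l (0, y)).
  move=> k x y.
  have -> : (0, k *: x + y) = k *: (0, x) + (0, y) :> V * W.
    by apply: injective_projections; rewrite /= ?scaler0 ?addr0.
  by rewrite linearP.
have := regularD (regular_scalar s1 hg) (regular_scalar s2 hh).
apply: regular_ext => t _; rewrite -linearD; congr (l _).
by apply: injective_projections; rewrite /= ?addr0 ?add0r.
Qed.

Lemma morphism_linear V W (A : set V) (B : set W) (h : {linear V -> W}) :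
  (forall x, A x -> B (h x)) -> is_morphism A B h.
Proof.
move=> H; split=> // l; apply: (@regular_scalar_id _ _ _ (l \o h)).
by move=> a x y /=; rewrite !linearP.
Qed.

End OneParameter.

(** * Matrix groups, roots and the torus *)

Section MatrixGroups.
Context {K : numFieldType} {n : nat}.
Local Notation M := 'M[K]_n.
Implicit Types (G T H S : set M).

Lemma subgroup_mulVmx G g : is_subgroup G -> G g -> invmx g *m g = 1%:M.
Proof. by move=> [h _ _ _] /h; apply: mulVmx. Qed.

Lemma subgroup_mulmxV G g : is_subgroup G -> G g -> g *m invmx g = 1%:M.
Proof. by move=> [h _ _ _] /h; apply: mulmxV. Qed.

Lemma subgroup_idem G g : is_subgroup G -> G g -> g *m g = g -> g = 1%:M.
Proof.
move=> hG Gg /(congr1 (mulmx (invmx g))); rewrite mulmxA.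
by rewrite (subgroup_mulVmx hG Gg) mul1mx.
Qed.

Lemma subgroup_prod G (J : Type) (s : seq J) (F : J -> M) :
  is_subgroup G -> (forall j, G (F j)) -> G (\prod_(j <- s) F j).
Proof.
by move=> [_ h1 hM _] hF; apply: big_ind => //; apply: hM.
Qed.

Lemma invmx_unique (g h : M) : g *m h = 1%:M -> invmx g = h.
Proof.
move=> e; have /mulmx1_unit[gu _] := e.
by rewrite -[h]mul1mx -(mulVmx gu) -mulmxA e mulmx1.
Qed.

Lemma is_subgroup_GL : is_subgroup (GL : set M).
Proof.
split=> //; first exact: unitmx1.
  by move=> A B hA hB; rewrite /GL /= unitmx_mul; apply/andP.
by move=> A hA; rewrite /GL /= unitmx_inv.
Qed.

Lemma subset_generated S : S `<=` generated S.
Proof. by move=> g Sg H _; apply. Qed.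

Lemma is_subgroup_generated S : S `<=` GL -> is_subgroup (generated S).
Proof.
move=> SGL; split.
- by move=> g; apply=> //; apply: is_subgroup_GL.
- by move=> H [].
- by move=> A B hA hB H hH SH; have [_ _ hM _] := hH; apply: hM; [apply: hA|apply: hB].
- by move=> A hA H hH SH; have [_ _ _ hV] := hH; apply: hV; apply: hA.
Qed.

(* Inverses are carried along, so that inversion needs no polynomial formula. *)
Lemma generated_line_connected S : S `<=` GL ->
  (forall g, S g -> exists c d : K^o -> M,
     [/\ is_morphism setT (generated S) c, is_morphism setT (generated S) d,
         forall t, c t *m d t = 1%:M, c 0 = 1%:M & c 1 = g]) ->
  line_connected (generated S).
Proof.
move=> SGL HS.
have hgen := is_subgroup_generated SGL; have [hGL h1 hM hV] := hgen.
pose H g := generated S g /\ exists c d : K^o -> M,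
     [/\ is_morphism setT (generated S) c, is_morphism setT (generated S) d,
         forall t, c t *m d t = 1%:M, c 0 = 1%:M & c 1 = g].
have HH : is_subgroup H.
  split.
  - by move=> g [/hGL].
  - split=> //; exists (fun=> 1%:M), (fun=> 1%:M); split=> //; try exact: morphism_cst.
    by move=> t; rewrite mulmx1.
  - move=> g h [Gg [c [d [hc hd cd c0 c1]]]] [Gh [c' [d' [hc' hd' cd' c0' c1']]]].
    split; first exact: hM.
    exists (fun t => c t *m c' t), (fun t => d' t *m d t); split.
    + by apply: (morphism_mulmx _ hc hc') => t _; apply: hM; [apply: hc.1|apply: hc'.1].
    + by apply: (morphism_mulmx _ hd' hd) => t _; apply: hM; [apply: hd'.1|apply: hd.1].
    + by move=> t; rewrite mulmxA -(mulmxA (c t)) cd' mulmx1 cd.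
    + by rewrite c0 c0' mulmx1.
    + by rewrite c1 c1'.
  - move=> g [Gg [c [d [hc hd cd c0 c1]]]]; split; first exact: hV.
    exists d, c; split=> //.
    + by move=> t; apply: mulmx1C.
    + by have := cd 0; rewrite c0 mul1mx.
    + by rewrite -c1 (invmx_unique (cd 1)).
have hgH : generated S `<=` H.
  by move=> g /(_ H HH); apply=> s Ss; split; [apply: subset_generated|apply: HS].
move=> a b ga gb.
have /hgH[_ [c [d [hc _ _ c0 c1]]]] := hM _ _ (hV _ ga) gb.
exists (fun t => a *m c t); last first.
  by rewrite c0 c1 mulmx1 mulmxA (subgroup_mulmxV hgen) // mul1mx.
apply: (morphism_mulmx _ (@morphism_cst _ _ _ setT _ _ ga) hc) => t _.
by apply: hM => //; apply: hc.1.
Qed.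

End MatrixGroups.

(** * Root homomorphisms, characters and cocharacters *)

Section Roots.
Context {K : numFieldType} {n : nat}.
Local Notation M := 'M[K]_n.
Implicit Types (G T U H S : set M).

Lemma root_homP G T beta (x : K^o -> M) : is_subgroup G -> root_hom G T beta x ->
  [/\ is_morphism setT G x, x 0 = 1%:M, forall a b, x (a + b) = x a *m x b &
      forall t c, T t -> t *m x c *m invmx t = x (beta t * c)].
Proof.
move=> hG [hx [hm _] hadd hT]; split=> //.
  by split=> // l; apply: hm.2.
by apply: (subgroup_idem hG (hx 0)); rewrite -hadd addr0.
Qed.

(** Differentiating [t x(c) t^-1 = x(beta(t) c)] at [c = 0] in two ways shows that the derivative of
    [x] has weight [beta]; it is tangent to [G] because [x] maps into [G]. *)
Lemma root_hom_differential G T beta (x : K^o -> M) : is_subgroup G ->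
  root_hom G T beta x ->
  exists2 X, root_space G T beta X & is_differential setT x 0 1 X.
Proof.
move=> hG /(root_homP hG)[hx x0 xD xT].
have [X hX] := is_differential_ex 1 hx (I : setT 0).
exists X => //; split.
  rewrite /Lie -x0; apply: (tangent_space_differential I hx.1 hX).
  by apply: (@tangent_line _ setT 1 (oner_neq0 _)).
move=> t Tt.
have tl := @tangent_line K setT 1 (oner_neq0 _) (fun _ _ => I) 0 1.
apply: (@is_differential_mx_uniq _ _ _ setT (fun c => t *m x c *m invmx t) 0 1 _ _ I tl).
- have C B := is_differential_cst setT (B : M) (0 : K^o) 1.
  have := is_differential_mulmx I (is_differential_mulmx I (C t) hX) (C (invmx t)).
  by rewrite mul0mx mulmx0 addr0 add0r.
- have D : is_differential setT (fun c : K^o => (beta t : K) * c : K^o) 0 1 ((beta t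
    : K) *: (1 : K^o)).
    apply: is_differential_Ko => //.
    have := deriv_atM (I : setT (0 : K^o)) (deriv_at_cst setT 0 1 (beta t : K))
      (deriv_at_Ko_id setT 0 1).
    by rewrite mul0r add0r.
  have E : is_differential setT x ((beta t : K) * (0 : K^o)) ((beta t : K) *: (1 :
    K^o)) ((beta t : K) *: X).
    by rewrite mulr0; apply: is_differentialZ.
  have := is_differential_comp I (fun _ _ => I) D E.
  by apply: is_differential_ext => c _; rewrite /= xT.
Qed.

Lemma inv_is_character T beta : is_character T beta -> is_character T (inv_char beta).
Proof.
move=> [hb bM]; have b0 t : T t -> beta t != 0 by apply: hb.1.
split.
  apply: morphism_Ko; first by move=> t Tt; rewrite /Gm /= invr_eq0; apply: b0.
  exact: (regularV b0 (regular_Ko hb)).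
by move=> s t Ts Tt; rewrite /inv_char bM // invfM.
Qed.

Lemma character1 T chi : is_subgroup T -> is_character T chi -> chi 1%:M = 1.
Proof.
move=> [_ T1 _ _] [h hM]; have := hM _ _ T1 T1; rewrite mulmx1 => e.
by apply: (mulfI (h.1 _ T1)); rewrite mulr1 -e.
Qed.

Lemma character_prod T chi (J : Type) (s : seq J) (F : J -> M) :
  is_subgroup T -> is_character T chi -> (forall j, T (F j)) ->
  chi (\prod_(j <- s) F j) = \prod_(j <- s) chi (F j).
Proof.
move=> hT hc hF; elim: s => [|j s IH]; first by rewrite !big_nil (character1 hT hc).
rewrite !big_cons -IH; apply: (hc.2) => //.
exact: (subgroup_prod _ hT hF).
Qed.

Lemma torus_comm T s t : is_torus T -> T s -> T t -> s *m t = t *m s.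
Proof.
move=> [_ [r [phi [[_ [psi [hpsi _ psiK]]] hM]]]] Ts Tt.
have Ps := hpsi.1 _ Ts; have Pt := hpsi.1 _ Tt.
rewrite -(psiK s Ts) -(psiK t Tt) -!hM //; congr (phi _).
by apply/rowP => j; rewrite !mxE mulrC.
Qed.

Lemma cocharacter1 T lam : is_subgroup T -> is_cocharacter T lam -> lam 1 = 1%:M.
Proof.
move=> hT [h hM]; apply: (subgroup_idem hT); first by apply: h.1; apply: oner_neq0.
by rewrite -hM ?mulr1 //; apply: oner_neq0.
Qed.

(** The factors of the two products have to be interleaved, which the commutativity of the torus
    permits. *)
Lemma cocharacter_prodM T (J : Type) (s : seq J) (lam : J -> K^o -> M) (a b : J -> K) :
  is_torus T -> (forall j, is_cocharacter T (lam j)) ->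
  (forall j, a j != 0) -> (forall j, b j != 0) ->
  \prod_(j <- s) lam j (a j * b j) =
  (\prod_(j <- s) lam j (a j)) *m (\prod_(j <- s) lam j (b j)).
Proof.
move=> hT hlam a0 b0; have hTg := hT.1.1.
have TT c : (forall j, c j != 0) -> forall j, T (lam j (c j)).
  by move=> c0 j; apply: (hlam j).1.1; apply: c0.
elim: s => [|j s IH]; first by rewrite !big_nil mulmx1.
rewrite !big_cons IH (hlam j).2 //; last 2 first; try by [apply: a0|apply: b0].
rewrite -!mulmxE -!mulmxA; congr (_ *m _).
rewrite !mulmxA; congr (_ *m _).
by apply: (torus_comm hT); [apply: TT|apply: subgroup_prod => //; apply: TT].
Qed.

(** In coordinates, T is a product of copies of Gm, and [cc j] followed by [phi] is the cocharacter
    of the [j]-th factor. Simple connectedness writes it through the coroots with exponents [m j];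
    multiplying over [j] expresses an arbitrary element. *)
Lemma torus_coroots T (J : finType) (lam : J -> K^o -> M) t :
  is_torus T -> (forall j, is_cocharacter T (lam j)) -> simply_connected T lam ->
  T t -> exists2 c : J -> K, forall j, c j != 0 & t = \prod_j lam j (c j).
Proof.
move=> hT hlam hsc Tt; have hTg := hT.1.1.
have [_ [r [phi [[hphi [psi [hpsi _ psiK]]] hM]]]] := hT.
pose v := psi t; have Pv : Gm_pow v by apply: hpsi.1.
pose cc (j : 'I_r) (c : K^o) : 'rV[K]_r := \row_k (if k == j then (c : K) else 1).
have Pcc j c : c != 0 -> Gm_pow (cc j c).
  by move=> c0 k; rewrite mxE; case: (k == j); [exact: c0|exact: oner_neq0].
have hcc j : is_cocharacter T (fun c => phi (cc j c)).
  split; last first.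
    move=> a b a0 b0; rewrite -hM; try exact: Pcc.
    congr (phi _); apply/rowP => k; rewrite !mxE.
    by case: eqP => // _; rewrite mulr1.
  apply: morphism_comp hphi.
  (* The row [cc j c] is affine in [c]: its constant term [cc j 0] has 0 in place [j] and 1
     elsewhere. *)
  have h : is_morphism Gm (@Gm_pow K r) (fun c : K^o => (c : K) *: (delta_mx 0 j) +
    (cc j 0)).
    apply: morphism_affine => c c0 k; rewrite !mxE eqxx /=.
    case: (k == j); first by rewrite mulr1 addr0.
    by rewrite mulr0 add0r oner_neq0.
  apply: morphism_ext h => c c0; apply/rowP => k; rewrite !mxE eqxx /=.
  by case: eqP => _; rewrite ?mulr1 ?mulr0 ?addr0 ?add0r.
have /(_ _)/cid-m := fun j => hsc _ (hcc j).
pose c (s : seq 'I_r) i := \prod_(j <- s) v 0 j ^ (sval (m j) i).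
have c0 s i : c s i != 0.
  by rewrite /c prodf_seq_neq0; apply/allP => j _ /=; rewrite expfz_neq0 // Pv.
have H (s : seq 'I_r) : uniq s ->
    phi (\row_k (if k \in s then v 0 k else 1)) = \prod_i lam i (c s i).
  elim: s => [|j s IH] /= => [_|/andP[js us]].
    have -> : \row_k (if k \in [::] then v 0 k else 1) = const_mx 1 :> 'rV_r.
      by apply/rowP => k; rewrite !mxE.
    rewrite big1 => [|i _]; last by rewrite /c big_nil (cocharacter1 hTg (hlam i)).
    have P1 : @Gm_pow K r (const_mx 1) by move=> k; rewrite mxE oner_neq0.
    apply: (subgroup_idem hTg); first exact: hphi.1.
    by rewrite -hM //; congr (phi _); apply/rowP => k; rewrite !mxE mulr1.
  transitivity (phi (cc j (v 0 j)) *m phi (\row_k (if k \in s then v 0 k else 1))).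
    rewrite -hM; first 1 last.
    - by apply: Pcc; apply: Pv.
    - by move=> k; rewrite mxE; case: (k \in s); [apply: Pv|apply: oner_neq0].
    congr (phi _); apply/rowP => k; rewrite !mxE inE.
    by case: eqP => [->|_]; rewrite ?(negPf js) ?mulr1 ?mul1r.
  rewrite IH // (svalP (m j)); last exact: Pv.
  rewrite -(cocharacter_prodM _ hT hlam).
  - by apply: eq_bigr => i _; rewrite /c big_cons.
  - by move=> i; rewrite expfz_neq0 // Pv.
  - by move=> i; apply: c0.
exists (c (enum 'I_r)); first exact: c0.
rewrite -H ?enum_uniq // -(psiK t Tt); congr (phi _).
by apply/rowP => k; rewrite mxE mem_enum.
Qed.

(** * Weights of T and of its Lie algebra along a cocharacter *)

Section WeightsAlongCocharacters.
Context {T : set M} {lam : K^o -> M} {H : M}.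
Hypotheses (hT : is_subgroup T) (hlam : is_cocharacter T lam).
Hypothesis hH : is_differential Gm lam 1 1 H.

Let one_Gm : Gm (1 : K^o). Proof. exact: oner_neq0. Qed.

(** Differentiating [lam(s) X = beta(lam s) X lam(s)] at [s = 1] gives [H X = b X + X H]. *)
Lemma bracket_weight (beta : M -> K^o) (b : K) X :
  deriv_at Gm 1 1 (fun s => beta (lam s) : K) b -> is_character T beta ->
  (forall t, T t -> t *m X *m invmx t = (beta t : K) *: X) ->
  bracket H X = b *: X.
Proof.
move=> hb hbeta hX.
have C := is_differential_cst Gm X (1 : K^o) 1.
have e1 := is_differential_mulmx one_Gm hH C.
have e2 := is_differential_scale one_Gm hb (is_differential_mulmx one_Gm C hH).
have l1 := cocharacter1 hT hlam.
rewrite !l1 mulmx0 addr0 in e1.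
rewrite !l1 (character1 hT hbeta) mulmx1 mul0mx add0r scale1r in e2.
rewrite /bracket; apply/eqP; rewrite subr_eq; apply/eqP.
apply: (is_differential_mx_uniq one_Gm _ e1); last first.
  apply: is_differential_ext e2 => c c0 /=.
  have Tc := hlam.1.1 c c0.
  rewrite scalemxAl -hX // -!mulmxA (subgroup_mulVmx hT Tc) mulmx1 //.
apply: (@tangent_line _ Gm 'X (negbT (polyX_eq0 _))).
by move=> c; rewrite hornerX.
Qed.

(** The curve [beta(lam s) lam(s) Y lam(s)^-1] has derivative [b Y + [H, Y] = 0] at 1. By the group
    law it is then constant on Gm, equal to its value [Y] at 1. *)
Lemma weight_bracket (beta : M -> K^o) (b : K) Y :
  deriv_at Gm 1 1 (fun s => beta (lam s) : K) b -> is_character T beta ->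
  bracket H Y = - b *: Y ->
  forall c, Gm c -> (beta (lam c) : K) *: (lam c *m Y) = Y *m lam c.
Proof.
move=> hb hbeta hY.
have l1 := cocharacter1 hT hlam; have b1 := character1 hT hbeta.
have inv1 : is_morphism Gm Gm (fun s : K^o => (s : K)^-1 : K^o).
  apply: morphism_Ko => [s|]; first by rewrite /Gm /= invr_eq0.
  exact: (regularV (fun s s0 => s0) (regular_scalar_id (@scalarKo_id K))).
have dinv : is_differential Gm (fun s : K^o => (s : K)^-1 : K^o) 1 1 (-1 *: (1 : K^o)).
  apply: is_differential_Ko => //.
  have := @deriv_at_div K _ Gm (1 : K^o) 1 (fun=> 1) (fun s => s : K) (fun s => (s :
    K)^-1) 0 1 one_Gm one_Gm.
  rewrite mul0r mulr1 sub0r expr1n divr1 => h; rewrite scaleN1r; apply: h.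
  - by move=> s _ _; rewrite div1r.
  - exact: deriv_at_cst.
  - exact: deriv_at_Ko_id.
(* [lam (s^-1)] serves as the inverse of [lam s], which makes [F] a product of visible morphisms. *)
pose F (s : K^o) : M := (beta (lam s) : K) *: (lam s *m Y *m lam ((s : K)^-1)).
have mF : is_morphism Gm setT F.
  split=> // l.
  have m1 : is_morphism Gm setT (fun s : K^o => lam s *m Y *m lam ((s : K)^-1)).
    apply: (@morphism_mulmx _ _ _ _ setT setT) => //.
      apply: (@morphism_mulmx _ _ _ _ T setT) => //; first exact: hlam.1.
      exact: morphism_cst.
    by apply: (morphismS _ _ (morphism_comp inv1 hlam.1)).
  have := regularM (regular_Ko (morphism_comp hlam.1 hbeta.1)) (m1.2 l).
  by apply: regular_ext => c _; rewrite linearZ.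
have dF : is_differential Gm F 1 1 0.
  have C := is_differential_cst Gm Y (1 : K^o) 1.
  have D : is_differential Gm (lam \o (fun s : K^o => (s : K)^-1 : K^o)) 1 1 (-1 *: H).
    apply: (is_differential_comp one_Gm inv1.1 dinv).
    by rewrite invr1; apply: is_differentialZ.
  have := is_differential_scale one_Gm hb (is_differential_mulmx one_Gm
    (is_differential_mulmx one_Gm hH C) D).
  rewrite /= invr1 !l1 b1 mulmx0 addr0 mul1mx !mulmx1 scale1r scaleN1r mulmxN.
  by rewrite -/(bracket H Y) hY scaleNr subrr.
move=> c c0.
have Tc := hlam.1.1 c c0.
have cc : lam (c : K)^-1 *m lam c = 1%:M.
  by rewrite -hlam.2 ?mulVf ?l1 // /Gm /= invr_eq0.
suff e : F c = Y.
  by rewrite -{2}e /F -scalemxAl -!mulmxA cc mulmx1.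
apply: vect_separate => l.
have -> : Y = F 1 by rewrite /F invr1 l1 b1 scale1r mul1mx mulmx1.
apply: (multiplicative_cst (mF.2 l)); [|exact: c0|exact: oner_neq0].
move=> {Tc cc c0} c c0.
(* [F (s c)] is the image of [F s] under a linear map depending on [c] alone; [l'] is the composite
   of [l] with that map, so the zero derivative at 1 passes to every translate. *)
pose l' (Z : M) := (beta (lam c) : K) * l (lam c *m Z *m lam (c : K)^-1).
have sl' : scalar l'.
  move=> a x y; rewrite /l' mulmxDr mulmxDl -scalemxAr -scalemxAl linearP.
  by rewrite mulrDr mulrCA.
have := deriv_at_scalar sl' dF.
rewrite /l' mulmx0 mul0mx raddf0 mulr0.
apply: deriv_at_ext => // s s0.
have s0' : Gm ((s : K)^-1 : K^o) by rewrite /Gm /= invr_eq0.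
have c0' : Gm ((c : K)^-1 : K^o) by rewrite /Gm /= invr_eq0.
rewrite /F -scalemxAr -scalemxAl linearZ /= mulrA.
rewrite [(s : K) * c]mulrC hlam.2 // hbeta.2 //; try exact: hlam.1.1.
rewrite linearZ /=; congr (_ * l _).
by rewrite invfM mulrC [in RHS]hlam.2 // !mulmxA.
Qed.

End WeightsAlongCocharacters.

(* The Chevalley involution is -1 on Lie T, so it negates the weights of Lie T;
   integrating along the coroots turns this into a statement about T. *)
Lemma chevalley_involution_root_space (J : finType) G T (lam : J -> K^o -> M)
    (e f : J -> M) (omega : M -> M) (beta : M -> K^o) (X : M) :
  is_subgroup G -> T `<=` G -> is_torus T -> (forall j, is_cocharacter T (lam j)) ->
  simply_connected T lam -> chevalley_involution G T e f omega ->
  is_character T beta -> root_space G T beta X ->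
  root_space G T (inv_char beta) (omega X).
Proof.
move=> hG TG hT hlam hsc [hLie hlin hbr _ hneg] hbeta [LX hX].
have hTg := hT.1.1.
have L0 : Lie G 0.
  by move=> P hP P0; apply: poly_deriv0.
have om0 : omega 0 = 0.
  have := hlin 1 0 0 L0 L0; rewrite !scale1r addr0 => /eqP.
  by rewrite -[X in X == _]addr0 (inj_eq (addrI _)) => /eqP.
have omZ a Z : Lie G Z -> omega (a *: Z) = a *: omega Z.
  by move=> LZ; have := hlin a Z 0 LZ L0; rewrite om0 !addr0.
split; first exact: (hLie _ LX).1.
move=> t Tt.
(* This form of the weight condition is free of inverses and stable under products, so it can be
   checked on single coroot values. *)
suff e0 : (beta t : K) *: (t *m omega X) = omega X *m t.
  have b0 : (beta t : K) != 0 by apply: hbeta.1.1.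
  rewrite /inv_char -[LHS]scale1r -(mulVf b0) -scalerA; congr (_ *: _).
  by rewrite scalemxAl e0 -mulmxA (subgroup_mulmxV hTg) // mulmx1.
have [c c0 ->] := torus_coroots hT hlam hsc Tt.
have Tj j : T (lam j (c j)) by apply: (hlam j).1.1; apply: c0.
suff [] : T (\prod_j lam j (c j)) /\
  (beta (\prod_j lam j (c j)) : K) *: (\prod_j lam j (c j) *m omega X) =
  omega X *m \prod_j lam j (c j) by [].
apply: (@big_ind _ (fun s => T s /\ (beta s : K) *: (s *m omega X) = omega X *m s)).
- have [_ T1 _ _] := hTg; split=> //.
  by rewrite (character1 hTg hbeta) scale1r mul1mx mulmx1.
- move=> x y [Tx hx] [Ty hy]; have [_ _ TM _] := hTg; split; first exact: TM.
  rewrite -mulmxE hbeta.2 // -scalerA -mulmxA.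
  rewrite [(beta y : K) *: _]scalemxAr hy (mulmxA x) scalemxAl hx.
  by rewrite -mulmxA.
- move=> j _; split=> //; have one_Gm : Gm (1 : K^o) by apply: oner_neq0.
  have [H hH] := is_differential_ex 1 (hlam j).1 one_Gm.
  have [b hb] := regular_deriv 1 (regular_Ko (morphism_comp (hlam j).1 hbeta.1)) one_Gm.
  apply: (weight_bracket hTg (hlam j) hH hb hbeta); last exact: c0.
  have LTH : Lie T H.
    rewrite /Lie -(cocharacter1 hTg (hlam j)).
    apply: (tangent_space_differential one_Gm (hlam j).1.1 hH).
    apply: (@tangent_line _ Gm 'X (negbT (polyX_eq0 _))).
    by move=> s; rewrite hornerX.
  have LGH : Lie G H by apply: tangent_spaceS LTH.
  (* Applying [omega] to [[H, X] = b X] with [omega H = - H] yields [[H, omega X] = - b omega X]. *)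
  have := hbr H X LGH LX; rewrite (hneg _ LTH).
  rewrite (bracket_weight hTg (hlam j) hH hb hbeta hX) omZ //.
  by rewrite /bracket mulNmx mulmxN -opprD scaleNr => ->; rewrite opprK.
Qed.

End Roots.

(** * Representations *)

Section Representations.
Context {K : numFieldType} {n : nat} {V : vectType K}.
Local Notation M := 'M[K]_n.
Implicit Types (G T U H : set M) (rho : M -> 'End(V)).

(** The span of an arbitrary set, realised by a finite family in [S] whose span has the largest
    dimension: adjoining any element of [S] cannot enlarge it. *)
Lemma span_set (S : set V) : exists W : {vspace V}, (forall x, S x -> x \in W) /\
  forall h : V -> K, scalar h -> (forall x, S x -> h x = 0) -> forall w, w \in W -> h w = 0.
Proof.
pose P d := `[< exists s : seq V, (forall x, x \in s -> S x) /\ \dim <<s>>%VS = d >].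
have exP : exists d, P d by exists (\dim <<[::] : seq V>>%VS); apply/asboolP; exists [::].
have Pub d : P d -> (d <= \dim {: V})%N.
  by move=> /asboolP[s [_ <-]]; apply/dimvS/subvf.
have [d /asboolP[s [sS sd]] dmax] := ex_maxnP exP Pub.
exists <<s>>%VS; split=> [x Sx|h /scalar_linear[l <-] lS w].
  suff -> : <<s>>%VS = <<x :: s>>%VS by rewrite memv_span ?mem_head.
  apply/eqP; rewrite eqEdim; apply/andP; split.
    by apply: sub_span => y ys; rewrite inE ys orbT.
  rewrite sd; apply: dmax; apply/asboolP; exists (x :: s); split=> // y.
  by rewrite inE => /orP[/eqP ->|/sS].
move=> /(@coord_span _ _ _ (in_tuple s)) ->; rewrite linear_sum big1 // => i _.
by rewrite linearZ /= lS ?mulr0 //; apply/sS/mem_nth.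
Qed.

Lemma scalar_lfun_apply (h : V -> K) w : scalar h -> scalar (fun E : 'End(V) => h (E w)).
Proof. by move=> hs a x y; rewrite add_lfunE scale_lfunE hs. Qed.

Lemma drho_differential G rho X : is_subgroup G -> rational_rep G rho ->
  is_differential G rho 1%:M X (drho G rho X).
Proof. by move=> [_ G1 _ _] [hr _ _]; apply: differentialP hr G1. Qed.

(** Writing [x(s + c)] as [x(c) x(s)] lets the derivative at [s = 0] act on [w] first, where it
    gives 0. *)
Lemma root_hom_fix_vector G T beta (x : K^o -> M) X rho w : is_subgroup G ->
  rational_rep G rho ->
  root_hom G T beta x -> is_differential setT x 0 1 X -> drho G rho X w = 0 ->
  forall c, rho (x c) w = w.
Proof.
move=> hG hrho /(root_homP hG)[hx x0 xD _] hX Xw c.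
have [hr r1 rM] := hrho.
apply: vect_separate => l.
have sl w' := @scalar_lfun_apply l w' (fun a y z => linearP l a y z).
have -> : l w = l (rho (x 0) w) by rewrite x0 r1 id_lfunE.
apply: (additive_cst (regular_scalar (sl w) (morphism_comp hx hr))) => {}c.
have sc : scalar (fun w => l (rho (x c) w)) by move=> a y z; rewrite !linearP.
have D : is_differential setT (rho \o x) 0 1 (drho G rho X).
  apply: (is_differential_comp I hx.1 hX); rewrite x0; exact: drho_differential.
have := deriv_at_scalar (scalar_lfun_apply w sc) D.
rewrite Xw !raddf0; apply: deriv_at_ext => // s _ /=.
by rewrite addrC xD rM ?comp_lfunE //; apply: hx.1.
Qed.

(** Dual to [root_hom_fix_vector]: here [x(s + c)] is read as [x(s) x(c)], so that the derivative
    acts last and is met by [h]. *)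
Lemma root_hom_fix_scalar G T beta (x : K^o -> M) X rho (h : V -> K) :
  is_subgroup G -> rational_rep G rho -> scalar h ->
  root_hom G T beta x -> is_differential setT x 0 1 X ->
  (forall w, h (drho G rho X w) = 0) ->
  forall c w, h (rho (x c) w) = h w.
Proof.
move=> hG hrho sh /(root_homP hG)[hx x0 xD _] hX Xh c w.
have [hr r1 rM] := hrho.
have -> : h w = h (rho (x 0) w) by rewrite x0 r1 id_lfunE.
apply: (additive_cst (regular_scalar (scalar_lfun_apply w sh) (morphism_comp hx hr)))
  => {}c.
have D : is_differential setT (rho \o x) 0 1 (drho G rho X).
  apply: (is_differential_comp I hx.1 hX); rewrite x0; exact: drho_differential.
have := deriv_at_scalar (scalar_lfun_apply (rho (x c) w) sh) D.
rewrite Xh; apply: deriv_at_ext => // s _ /=.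
by rewrite xD rM ?comp_lfunE //; apply: hx.1.
Qed.

Lemma polyfun_comp_linear (W1 W2 : lmodType K) (g : {linear W1 -> W2}) (P : W2 -> K) :
  polyfun P -> polyfun (fun x => P (g x)).
Proof.
elim=> [c|l|{}P Q _ hP _ hQ|{}P Q _ hP _ hQ].
- exact: polyfun_const.
- have /scalar_linear[l' <-] : scalar (fun x => l (g x)).
    by move=> a x y; rewrite !linearP.
  exact: polyfun_linear.
- exact: polyfun_add.
- exact: polyfun_mul.
Qed.

(* The span of the Omega-orbit is stable under Lie G, because a *m g stays in
   Omega for a near 1. *)
Lemma irreducible_orbit_span G (Omega : set M) rho (u : V) (h : V -> K) :
  is_subgroup G -> rational_rep G rho -> irreducible_module (Lie G) (drho G rho) ->
  zopen_in G Omega -> Omega 1%:M -> u != 0 -> scalar h ->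
  (forall g, Omega g -> h (rho g u) = 0) -> forall w, h w = 0.
Proof.
move=> hG hrho [_ irr] hO O1 u0 sh hu w.
have [_ G1 GM _] := hG; have [hr r1 rM] := hrho.
have [W [SW WS]] := span_set [set rho g u | g in Omega].
have uW : u \in W by apply: SW; exists 1%:M => //; rewrite r1 id_lfunE.
suff [W0|Wf] : W = 0%VS \/ W = fullv.
- by move: uW u0; rewrite W0 memv0 => ->.
- by apply: (WS h sh) => [_ [g Og <-]|]; [apply: hu|rewrite Wf memvf].
apply: irr => X y LX; pose q w := w - projv W w.
(* Membership in [W] becomes the linear equation [q z = 0], to be tested on functionals and, by
   [WS], only on the generators [rho g u]. *)
have qW z : q z = 0 -> z \in W.
  by move=> /eqP; rewrite subr_eq0 => /eqP ->; apply: memv_proj.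
move=> yW; apply: qW; apply: vect_separate => l; rewrite raddf0.
have slq : scalar (fun z => l (q z)).
  move=> a z z'; rewrite /q linearP opprD addrACA -scalerBr linearP //.
move: y yW; apply: WS.
  by move=> a z z'; rewrite linearP slq.
move=> _ [g Og <-].
have [Z [S hS ZE] OE] := hO.
have [Gg nZ] : G g /\ ~ Z g by move: Og; rewrite OE.
have [P SP Pg] : exists2 P, S P & P g != 0.
  apply: contrapT => H; apply: nZ; rewrite ZE => P SP.
  by apply: contrapT => /eqP Pg; apply: H; exists P.
apply: (deriv_at_uniq G1 LX (deriv_at_scalar (scalar_lfun_apply _ slq)
  (drho_differential X hG hrho))).
(* Where [P (a *m g)] is nonzero, [a *m g] stays in [Omega] and the function vanishes. This is the
   local expression [0 / P (a *m g)] at [a = 1], so the derivative is 0. *)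
have hQ : polyfun (fun a => P (mulmxr g a)) by apply: polyfun_comp_linear; apply: hS.
have [d hd] := poly_deriv_ex 1%:M X hQ.
exists (fun=> 0), (fun a => P (mulmxr g a)), 0, d; split.
- by split=> //; apply: polyfun_const.
- by rewrite /= mul1mx.
- move=> a Ga; rewrite /= => Pag; rewrite mul0r.
  have -> : rho a (rho g u) = rho (a *m g) u by rewrite rM // comp_lfunE.
  have Oag : Omega (a *m g).
    by rewrite OE; split; [apply: GM|rewrite ZE => /(_ _ SP)/eqP; rewrite (negPf Pag)].
  have /SW/projv_id e : [set rho g u | g in Omega] (rho (a *m g) u) by exists (a *m g).
  by rewrite /q e subrr raddf0.
- by split=> //; apply: poly_deriv_const.
- by rewrite !mul0r subrr mul0r.
Qed.

End Representations.

Section MatrixMorphisms.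
Context {K : numFieldType} {n : nat}.
Local Notation M := 'M[K]_n.

Lemma morphism_prod (V : lmodType K) (A : set V) (T : set M) (J : Type) (s : seq J)
  (F : J -> V -> M) :
  is_subgroup T -> (forall j, is_morphism A T (F j)) ->
  is_morphism A T (fun x => \prod_(j <- s) F j x).
Proof.
move=> hT hF; have [_ T1 TM _] := hT.
elim: s => [|j s IH].
  by apply: morphism_ext (morphism_cst A T1) => x _; rewrite big_nil.
have := morphism_mulmx (fun x Ax => TM _ _ ((hF j).1 x Ax) (IH.1 x Ax)) (hF j) IH.
by apply: morphism_ext => x _; rewrite big_cons.
Qed.

End MatrixMorphisms.

(** * Equivariance *)

Section Main.
Context {K : numFieldType} {n : nat} {I : finType}.
Local Notation M := 'M[K]_n.
Context {G T : set M} {alpha : I -> M -> K^o} {alphav : I -> K^o -> M} {e f : I -> M}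
  {Lam : I -> M -> K^o} {omega : M -> M} {L : I -> vectType K}
  {rho : forall i, M -> 'End(L i)} {u v : forall i, L i}
  {form : forall i, L i -> L i -> K}.
Arguments form : clear implicits.
Local Notation U := (Uplus G T alpha).
Local Notation Um := (Uminus G T alpha).
Local Notation mult3 := (fun p : M * (M * M) => p.1 *m p.2.1 *m p.2.2).
Hypotheses (hG : is_subgroup G) (hT : is_torus T) (TG : T `<=` G).
Hypothesis hef : chevalley_generators G T alpha alphav e f.
Hypothesis hsc : simply_connected T alphav.
Hypothesis hcell : open_embedding (Um `*` (T `*` U)) G mult3.
Hypothesis hLam : fundamental_weights T alphav Lam.
Hypothesis homega : chevalley_involution G T e f omega.
Hypothesis hL : forall i, irreducible_highest_weight G T alpha (Lam i) (rho i) (u i).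
Hypothesis hform : forall i, invariant_form (Lie G) (drho G (rho i))
       (twisted_action omega (drho G (rho i))) (form i).
Hypothesis hv : forall i, lowest_weight_vector G T alpha (rho i) (v i).
Hypothesis hvv : forall i, form i (v i) (v i) = 1.

Let hTg : is_subgroup T := hT.1.1.
Let halphav i : is_cocharacter T (alphav i).
Proof. by have [] := hef i. Qed.
Let hrho i : rational_rep G (rho i).
Proof. by have [] := hL i. Qed.

(** * Subgroups generated by the root subgroups of a family [P] of roots; U and U^- are the two
    instances *)

Section RootGenerated.
Context {P : (M -> K^o) -> Prop}.
Let S : set M := [set g | exists2 beta, P beta & root_subgroup G T beta g].

Let SG : S `<=` G.
Proof. by move=> _ [beta _ [x [c [[hx _ _ _] ->]]]]. Qed.

Let SGL : S `<=` GL.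
Proof. by have [h _ _ _] := hG; move=> g /SG/h. Qed.

Lemma root_generated_subgroup : is_subgroup (generated S).
Proof. exact: is_subgroup_generated. Qed.

Lemma root_generated_sub : generated S `<=` G.
Proof. by move=> g; apply. Qed.

Lemma root_generated_line_connected : line_connected (generated S).
Proof.
apply: generated_line_connected => // g [beta Pb [x [c [hx ->]]]].
have [mx x0 xD _] := root_homP hG hx.
(* The curves [x(t c)] and [x(- t c)] are mutually inverse, and the first joins the identity to
   [x c]. *)
have m (a : K) : is_morphism setT (generated S) (fun t : K^o => x ((t : K) *: (a :
  K^o) + 0)).
  have ma := @morphism_affine K K^o setT setT (a : K^o) 0 (fun _ _ => Logic.I).
  have := morphism_comp ma mx; apply: morphismS => // t _.
  by apply: subset_generated; exists beta => //; eexists; eexists; split; [exact: hx|].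
exists (fun t => x ((t : K) *: c + 0)), (fun t => x ((t : K) *: (- c) + 0)).
split=> //.
- by move=> t; rewrite !addr0 -xD scalerN subrr.
- by rewrite scale0r addr0.
- by rewrite scale1r addr0.
Qed.

(** Conjugation by [t] only rescales the parameter of each root homomorphism. The elements staying
    in the subgroup under it form a subgroup containing the generators. *)
Lemma root_generated_conj t g : T t -> generated S g -> generated S (t *m g *m invmx t).
Proof.
move=> Tt; have tV := subgroup_mulVmx hTg Tt; have Vt := subgroup_mulmxV hTg Tt.
have [gGL g1 gM gV] := root_generated_subgroup.
move=> /(_ [set g | generated S g /\ generated S (t *m g *m invmx t)]) H.
suff [] : [set g | generated S g /\ generated S (t *m g *m invmx t)] g by [].
apply: H.
  split.
  - by move=> x [/gGL].
  - by split=> //; rewrite mulmx1 Vt.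
  - move=> x y [gx gtx] [gy gty]; split; first exact: gM.
    by have := gM _ _ gtx gty; rewrite -!mulmxA (mulmxA _ t) tV mul1mx.
  - move=> x [gx gtx]; split; first exact: gV.
    suff -> : t *m invmx x *m invmx t = invmx (t *m x *m invmx t) by apply: gV.
    apply/esym/invmx_unique.
    rewrite -!mulmxA (mulmxA _ t) tV mul1mx (mulmxA x).
    by rewrite (subgroup_mulmxV root_generated_subgroup gx) mul1mx.
move=> s Ss; split; first exact: subset_generated.
apply: subset_generated; have [beta Pb [x [c [hx ->]]]] := Ss.
exists beta => //; exists x, (beta t * c); split=> //.
by have [_ _ _ ->] := hx.
Qed.

Lemma root_generated_ind (H : set M) : is_subgroup H ->
  (forall beta x c, P beta -> root_hom G T beta x -> H (x c)) -> generated S `<=` H.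
Proof.
by move=> hH h g; apply=> // _ [beta Pb [x [c [hx ->]]]]; apply: h hx.
Qed.

End RootGenerated.

Let hU : is_subgroup U := root_generated_subgroup.
Let hUm : is_subgroup Um := root_generated_subgroup.
Let UG : U `<=` G := @root_generated_sub _.
Let UmG : Um `<=` G := @root_generated_sub _.

Lemma Uplus_fix_highest i g : U g -> rho i g (u i) = u i.
Proof.
have [_ _ [_ hu]] := hL i; have [hr r1 rM] := hrho i.
have [GGL G1 GM GV] := hG.
suff h : U `<=` [set g | G g /\ rho i g (u i) = u i] by move=> /h[].
apply: root_generated_ind.
  split.
  - by move=> x [/GGL].
  - by split=> //; rewrite r1 id_lfunE.
  - move=> x y [Gx ex] [Gy ey]; split; first exact: GM.
    by rewrite rM // comp_lfunE ey ex.
  - move=> x [Gx ex]; split; first exact: GV.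
    rewrite -{1}ex -comp_lfunE -rM //; last exact: GV.
    by rewrite (subgroup_mulVmx hG Gx) r1 id_lfunE.
move=> beta x c pb hx; split; first by have [h _ _ _] := hx; apply: h.
have [X hX dX] := root_hom_differential hG hx.
apply: (root_hom_fix_vector hG (hrho i) hx dX).
exact: hu hX.
Qed.

Let form_scalar i w : scalar ((form i)^~ w).
Proof. by have [h _ _] := hform i; apply: h. Qed.

(** By invariance <X w, v^*> is minus the pairing of [w] with [omega X] acting on [v]. For a
    positive root vector [X], [omega X] lies in a negative root space and kills the lowest weight
    vector. *)
Lemma Uplus_fix_form i g w : U g -> form i (rho i g w) (v i) = form i w (v i).
Proof.
have [_ hlow] := hv i; have [hr r1 rM] := hrho i.
have [GGL G1 GM GV] := hG.
suff h : U `<=` [set g | G g /\ forall w, form i (rho i g w) (v i) = form i w (v i)].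
  by move=> /h[].
apply: root_generated_ind.
  split.
  - by move=> x [/GGL].
  - by split=> // w'; rewrite r1 id_lfunE.
  - move=> x y [Gx ex] [Gy ey]; split=> [|w']; first exact: GM.
    by rewrite rM // comp_lfunE ex ey.
  - move=> x [Gx ex]; split=> [|w']; first exact: GV.
    rewrite -ex -comp_lfunE -rM //; last exact: GV.
    by rewrite (subgroup_mulmxV hG Gx) r1 id_lfunE.
move=> beta x c pb hx; split; first by have [h _ _ _] := hx; apply: h.
have [X hX dX] := root_hom_differential hG hx.
apply: (root_hom_fix_scalar hG (hrho i) (form_scalar _) hx dX) => w'.
have [_ hr0 hinv] := hform i.
(* [X] is not known to be nonzero, so a nonzero root vector [X0] is used to show that
   [inv_char beta] is a root; [omega X0] is nonzero since [omega] is an involution. *)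
have [[hbeta hnt [X0 hX0 X0n0]] [m hm]] := pb.
have hoX0 := chevalley_involution_root_space hG TG hT halphav hsc homega hbeta hX0.
have hoX := chevalley_involution_root_space hG TG hT halphav hsc homega hbeta hX.
have /eqP := hinv X w' (v i) hX.1; rewrite /twisted_action (hlow (inv_char beta)) //.
  by have [l <-] := scalar_linear (hr0 w'); rewrite raddf0 addr0 => /eqP.
split; last first.
  by exists m => t Tt; rewrite /inv_char hm // -prodfV.
split; first exact: inv_is_character.
  by have [t Tt bt] := hnt; exists t => //; rewrite /inv_char invr_eq1.
exists (omega X0) => //; apply: contra_neq X0n0 => o0.
have [hLie hlin _ _ _] := homega.
rewrite -(hLie _ hX0.1).2 o0.
have [LX _] := hX0.
have := hlin (- 1) X0 X0 LX LX; rewrite o0 scaler0 addr0.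
by rewrite scaleN1r addNr.
Qed.

(** * The matrix coefficients on the open cell *)

Let fi i g : K := form i (rho i g (u i)) (v i).

Lemma coef_regular i : regular_on G (fi i).
Proof.
have [hr _ _] := hrho i.
exact: (regular_scalar (scalar_lfun_apply (u i) (form_scalar (v i))) hr).
Qed.

Lemma coef_Uplus i x g : U x -> G g -> fi i (x *m g) = fi i g.
Proof.
move=> Ux Gg; have [_ _ rM] := hrho i.
by rewrite /fi rM ?comp_lfunE ?(Uplus_fix_form _ Ux) //; apply: UG.
Qed.

Lemma coef_cell i g t x : Um g -> T t -> U x -> fi i (g *m t *m x) = Lam i t * fi i g.
Proof.
move=> Ug Tt Ux; have [_ _ rM] := hrho i; have [_ _ GM _] := hG.
have Gg := UmG Ug; have Gt := TG Tt; have Gx := UG Ux.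
rewrite /fi !rM //; last exact: GM.
rewrite !comp_lfunE (Uplus_fix_highest i Ux).
have [_ _ [[_ ht] _]] := hL i; rewrite (ht t Tt).
have [l hl] := scalar_linear (form_scalar (v i)).
have lE w : l w = form i w (v i) by rewrite hl.
by rewrite -!lE !linearZ.
Qed.

(** By [coef_cell], vanishing on U^- spreads to the open cell, a neighbourhood of 1. Then
    [irreducible_orbit_span] makes the pairing with [v i] zero on the whole module, against its
    value 1 at [v i]. *)
Lemma coef_neq0 i : exists2 g, Um g & fi i g != 0.
Proof.
apply: contrapT => H; have [hr hirr [[u0 _] _]] := hL i.
suff /(_ (v i))/eqP : forall w, form i w (v i) = 0 by rewrite hvv oner_eq0.
have [hO _] := hcell.
have [[_ Um1 _ _] [_ T1 _ _] [_ U1 _ _]] := And3 hUm hTg hU.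
apply: (irreducible_orbit_span hG hr hirr hO _ u0 (form_scalar (v i))).
  by exists (1%:M, (1%:M, 1%:M)); rewrite //= !mulmx1.
move=> _ [[g [t x]] [/= Ug [/= Tt Ux]] <-].
rewrite -/(fi i _) coef_cell //; apply/eqP; rewrite mulf_eq0; apply/orP; right.
by apply/negPn/negP => fg; apply: H; exists g.
Qed.

(** Once [t] is a product of coroot values, duality of fundamental weights and coroots reads off the
    parameters. *)
Lemma torus_weights t : T t -> t = \prod_i alphav i (Lam i t).
Proof.
move=> Tt; have [c c0 e'] := torus_coroots hT halphav hsc Tt.
rewrite {1}e'; apply: eq_bigr => i _; congr (alphav i _).
rewrite e' (character_prod _ hTg (hLam i).1); last first.
  by move=> j; apply: (halphav j).1.1; apply: c0.
rewrite (bigD1 i) //= (hLam i).2; last exact: c0.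
rewrite eqxx big1 ?mulr1 // => j ji.
by rewrite (hLam i).2 ?(eq_sym i) ?(negPf ji) //; apply: c0.
Qed.

(** * The torus factor of [F] and the two sides of the equivariance *)

Local Notation tf g := (\prod_i alphav i (fi i g)^-1).
Local Notation Bm := (set_mul Um T).

Lemma tf_torus g : (forall i, fi i g != 0) -> T (tf g).
Proof.
move=> g0; apply: subgroup_prod => // i; apply: (halphav i).1.1.
by rewrite /Gm /= invr_eq0.
Qed.

Lemma tf_morphism (V : lmodType K) (A : set V) (phi : V -> M) :
  is_morphism A G phi -> (forall x, A x -> forall i, fi i (phi x) != 0) ->
  is_morphism A T (fun x => tf (phi x)).
Proof.
move=> hphi h0; apply: morphism_prod => // i.
have m : is_morphism A Gm (fun x => (fi i (phi x))^-1 : K^o).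
  apply: morphism_Ko => [x Ax|]; first by rewrite /Gm /= invr_eq0 h0.
  by apply: regularV => [x Ax|]; [apply: h0|exact: (regular_comp hphi (coef_regular i))].
exact: (morphism_comp m (halphav i).1).
Qed.

(** From f_i(w) = Lam_i(t) f_i(g) neither factor on the right can vanish, so [F] is defined at the
    U^- part [g] of [x w], and inverting the relation compares the two torus factors. *)
Lemma tf_cell x w g t y : U x -> Um w -> Um g -> T t -> U y ->
  (forall i, fi i w != 0) -> x *m w = g *m t *m y ->
  (forall i, fi i g != 0) /\ tf g = t *m tf w.
Proof.
move=> Ux Uw Ug Tt Uy w0 E.
have E' i : fi i w = Lam i t * fi i g.
  by rewrite -(coef_Uplus i Ux (UmG Uw)) E coef_cell.
have g0 i : fi i g != 0.
  by apply: contra_neq (w0 i) => g0; rewrite E' g0 mulr0.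
have L0 i : Lam i t != 0.
  by apply: contra_neq (w0 i) => l0; rewrite E' [Lam i t]l0 mul0r.
split=> //; rewrite {1}(torus_weights Tt) -(cocharacter_prodM _ hT halphav) //; last first.
  by move=> i; rewrite invr_eq0.
apply: eq_bigr => i _; congr (alphav i _).
by rewrite E' invfM mulrA mulfV ?mul1r //; apply: L0.
Qed.

Local Notation F := (F_map Um alphav (fun i g => form i (rho i g (u i)) (v i))).

Lemma Uminus_neq0 : exists2 g, Um g & forall i, fi i g != 0.
Proof.
have [_ Um1 _ _] := hUm.
have [g Ug hg] := line_connected_all_neq0 (index_enum I) root_generated_line_connected
  (ex_intro _ _ Um1) (fun i => regular_onS UmG (coef_regular i)) coef_neq0.
by exists g => // i; apply: hg; rewrite mem_index_enum.
Qed.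

Lemma F_rational : is_rational Um Bm F.
Proof.
have hO := @zopen_regular_neq0 _ _ Um _ _ (fun i => regular_onS UmG (coef_regular i)).
set O := (X in zopen_in _ X) in hO.
have Fx x : O x -> forall y, F x y <-> y = x *m tf x.
  by move=> [Ux x0] y; split=> [[]|->].
exists O, (fun g => g *m tf g); split=> //.
  apply: zdense_line_connected => //; first exact: root_generated_line_connected.
  by have [g Ug hg] := Uminus_neq0; exists g.
have id_m : is_morphism O Um idfun by apply: morphism_linear => x [].
apply: (morphism_mulmx _ id_m (tf_morphism (morphismS _ _ id_m) _)) => //.
- by move=> x [Ux x0]; exists x, (tf x); split=> //; apply: tf_torus.
- by move=> x [/UmG].
- by move=> x [].
Qed.

Lemma F_equivariant : rational_equivariant U Um Bm (act_Um Um T U) (act_Bm Um T U) F.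
Proof.
have [hOm [hmult [psi [hpsi psiK _]]]] := hcell.
have [[_ Um1 UmM _] [_ T1 TM TV] [_ U1 UM UV]] := And3 hUm hTg hU.
have [_ _ GM GV] := hG.
set Om := (X in zopen_in _ X) in hOm.
pose X := U `*` Um.
have m1 : is_morphism X U fst by apply: morphism_linear => x [].
have m2 : is_morphism X Um snd by apply: morphism_linear => x [].
have m2G : is_morphism X G snd by apply: morphismS m2 => // x [_ /UmG].
have mm : is_morphism X G (fun p => p.1 *m p.2).
  by apply: (morphism_mulmx _ m1 m2) => x [/UG ? /UmG ?]; apply: GM.
pose O1 := [set p | X p /\ forall i, fi i p.2 != 0].
have hO1 : zopen_in X O1.
  exact: (zopen_regular_neq0 (fun i => regular_comp m2G (coef_regular i))).
(* [O1] is where [F] is defined at the second component, [O2] where the product lies in the open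
   cell. *)
pose O2 := X `&` (fun p => p.1 *m p.2) @^-1` Om.
have hO2 : zopen_in X O2 by exact: zopen_preimage mm hOm.
pose O := O1 `&` O2.
have OX : O `<=` X by move=> p [[]].
have mO : is_morphism O Om (fun p => p.1 *m p.2).
  by apply: morphismS mm => // p [_ []].
have mpsi := morphism_comp mO hpsi.
pose g (p : M * M) := (psi (p.1 *m p.2)).1; pose t (p : M * M) := (psi (p.1 *m p.2)).2.1.
have mg : is_morphism O Um g.
  by apply: (morphism_comp mpsi); apply: (morphism_linear (h := fst)) => x [].
have mt : is_morphism O T t.
  apply: (morphism_comp (morphism_comp mpsi (morphism_linear (h := snd) (B := T `*` U) _))).
    by move=> x [].
  by apply: (morphism_linear (h := fst)) => x [].
have mtf : is_morphism O T (fun p => tf p.2).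
  apply: tf_morphism; first by apply: (morphismS OX _ m2G) => p /OX; apply: m2G.1.
  by move=> p [[]].
(* Uniqueness of the factorization in the cell: it is recovered by the inverse [psi] of
   multiplication. *)
have decomp (p : M * M) a b c : Um a -> T b -> U c -> p.1 *m p.2 = a *m b *m c -> g p
  = a /\ t p = b.
  move=> Ua Tb Uc E; rewrite /g /t E.
  by have /= -> := psiK (a, (b, c)) (conj Ua (conj Tb Uc)).
have decompO p : O p -> exists y, [/\ Um (g p), T (t p), U y & p.1 *m p.2 = g p *m t
  p *m y].
  move=> [_ [_ [[a [b c]] [/= Ua [/= Tb Uc]] e']]].
  have [-> ->] := decomp p a b c Ua Tb Uc (esym e').
  by exists c; split.
exists O, (fun p => g p *m t p *m tf p.2); split.
- exact: zopen_inI.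
- apply: zdense_line_connected; first by apply: line_connectedX; apply:
    root_generated_line_connected.
    exact: zopen_inI.
  (* A point of [O]: the product of [1] and [w] is in the cell because [w = w 1 1]. *)
  have [w Uw w0] := Uminus_neq0; exists (1%:M, w); split; first by split.
  split; first by split.
  by exists (w, (1%:M, 1%:M)); rewrite //= !mulmx1 mul1mx.
- apply: (@morphism_mulmx _ _ _ _ Bm T); last exact: mtf.
    move=> p Op; exists (g p), (t p *m tf p.2).
    by split; [exact: mg.1|apply: TM; [exact: mt.1|exact: mtf.1]|rewrite mulmxA].
  apply: (morphism_mulmx _ mg mt) => p Op; exists (g p), (t p).
  by split=> //; [exact: mg.1|exact: mt.1].
- move=> p Op y; have [[[Up1 Up2] p20] _] := Op.
  have [z [Ugp Ttp Uz E]] := decompO p Op.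
  have [gp0 Egp] := tf_cell Up1 Up2 Ugp Ttp Uz p20 E.
  have {}Egp : g p *m tf (g p) = g p *m t p *m tf p.2 by rewrite Egp mulmxA.
  split.
    move=> [x' [_ _ [b [c [Ux' Tb Uc E']]]] [_ _ ->]].
    by have [<- _] := decomp p x' b c Ux' Tb Uc E'.
  move=> ->; exists (g p); last by split.
  by split=> //; exists (t p), z.
- move=> p Op y; have [[[Up1 Up2] p20] _] := Op.
  have [z [Ugp Ttp Uz E]] := decompO p Op.
  have Tp := tf_torus p20; have Vp := subgroup_mulmxV hTg Tp.
  have VVp := subgroup_mulVmx hTg Tp.
  split.
    move=> [y' [_ _ ->] [/= _ _ [a [b [c [Ua Tb Uc E' ->]]]]]].
    (* With tau the torus factor, [x u tau = a b c] becomes [x u = a (b tau^-1) (tau c tau^-1)],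
       again a factorization in the cell since T normalises U. *)
    have [|||| -> ->] := decomp p a (b *m invmx (tf p.2)) (tf p.2 *m c *m invmx (tf p.2)).
    + by [].
    + by apply: TM => //; apply: TV.
    + exact: root_generated_conj.
    + move/(congr1 (mulmxr (invmx (tf p.2)))): E'; rewrite /= -!mulmxA Vp mulmx1 => ->.
      by rewrite (mulmxA (invmx _)) VVp mul1mx.
    + by rewrite -!mulmxA VVp mulmx1.
  move=> ->; exists (p.2 *m tf p.2); first by split.
  split=> //=; first by exists p.2, (tf p.2).
  (* Conversely [x u = g t z] gives [x u tau = g (t tau) (tau^-1 z tau)]. *)
  exists (g p), (t p *m tf p.2), (invmx (tf p.2) *m z *m tf p.2); split=> //.
  + exact: TM.
  + have := root_generated_conj (TV _ Tp) Uz.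
    by rewrite (invmx_unique VVp).
  + by rewrite mulmxA E -!mulmxA (mulmxA (tf p.2) (invmx _)) Vp mul1mx.
  + by rewrite mulmxA.
Qed.

End Main.

Theorem lemma3p3 (R : realType) (n : nat) (I : finType)
    (G T : set 'M[R[i]]_n)
    (alpha : I -> 'M[R[i]]_n -> (R[i])^o) (alphav : I -> (R[i])^o -> 'M[R[i]]_n)
    (e f : I -> 'M[R[i]]_n)
    (Lam : I -> 'M[R[i]]_n -> (R[i])^o)
    (omega : 'M[R[i]]_n -> 'M[R[i]]_n)
    (L : I -> vectType R[i]) (rho : forall i, 'M[R[i]]_n -> 'End(L i))
    (u v : forall i, L i) (form : forall i, L i -> L i -> R[i])
    (hG : semisimple G)
    (hT : maximal_torus G T)
    (halpha : simple_roots G T alpha)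
    (hef : chevalley_generators G T alpha alphav e f)
    (hsc : simply_connected T alphav)
    (hcell : open_embedding
       (Uminus G T alpha `*` (T `*` Uplus G T alpha)) G
       (fun p => p.1 *m p.2.1 *m p.2.2))
    (hLam : fundamental_weights T alphav Lam)
    (homega : chevalley_involution G T e f omega)
    (hL : forall i, irreducible_highest_weight G T alpha (Lam i) (rho i) (u i))
    (hform : forall i, invariant_form (Lie G) (drho G (rho i))
       (twisted_action omega (drho G (rho i))) (form i))
    (hu : forall i, form i (u i) (u i) = 1)
    (hv : forall i, lowest_weight_vector G T alpha (rho i) (v i))
    (hvv : forall i, form i (v i) (v i) = 1) :
  let U := Uplus G T alpha in
  let Um := Uminus G T alpha in
  let Bm := set_mul Um T in
  let F := F_map Um alphav (fun i g => form i (rho i g (u i)) (v i)) in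
  is_rational Um Bm F /\
  rational_equivariant U Um Bm (act_Um Um T U) (act_Bm Um T U) F.
Proof.
have [[hGg _] _ _] := hG; have [hTt TG _] := hT.
move=> U Um Bm F; split.
  exact: (F_rational hGg hTt TG hef hcell hL hform hvv).
exact: (F_equivariant hGg hTt TG hef hsc hcell hLam homega hL hform hv hvv).
Qed.
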